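(* The following hold: (1) The group $CV$ has no odd torsion (no nontrivial element of finite odd order). (2) The group $CV$ has torsion of order $2^k$ (an element of order $2^k$) for every integer $k\ge1$. (3) Any finite subgroup of $CV$ is a $2$-group, that is, its order is a power of $2$. (4) The group $PCV$ is torsion-free.
   Context: Trees. A rooted binary tree is a single vertex or a finite rooted tree in which every non-leaf vertex has a left child and a right child; its $n$ leaves are numbered $1,\dots,n$ from left to right. A caret is the rooted binary tree with two leaves. Attaching a caret to a leaf means identifying the root of the caret with that leaf. Cactus groups. $J_1=\{1\}$; for $n\ge2$, $J_n$ is generated by $s_{i,j}$ $(1\le i<j\le n)$ with relations $s_{i,j}^2=1$; $s_{i,j}s_{k,l}=s_{k,l}s_{i,j}$ for $i<j<k<l$; $s_{i,j}s_{k,l}=s_{i+j-l,i+j-k}s_{i,j}$ for $i\le k<l\le j$. The homomorphism $\pi_n:J_n\to S_n$ sends $s_{i,j}$ to the permutation $m\mapsto i+j-m$ for $i\le m\le j$, fixing all other $m$. Permutations are composed left to right: $(\sigma\tau)(m)=\tau(\sigma(m))$. The cactus Thompson group $CV$. A cactus-tree pair is a triple $(T_+,s,T_-)$ with $T_\pm$ rooted binary trees with the same number $n$ of leaves and $s\in J_n$. For $1\le i\le n$, writing $s=s_{j_1,k_1}\cdots s_{j_l,k_l}$, put $p_1=i$ and let $p_{m+1}$ be the image of $p_m$ under $\pi_n(s_{j_m,k_m})$. Set $s'=s'_1\cdots s'_l\in J_{n+1}$, where $s'_m=s_{j_m,k_m}$ if $k_m<p_m$; $s'_m=s_{p_m,p_m+1}s_{j_m,k_m+1}$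 if $j_m\le p_m\le k_m$; $s'_m=s_{j_m+1,k_m+1}$ if $p_m<j_m$. Attaching a caret to leaf $i$ of $T_+$ and to leaf $\pi_n(s)(i)$ of $T_-$ gives $T'_+,T'_-$; the triple $(T'_+,s',T'_-)$ is called an expansion of $(T_+,s,T_-)$. $CV$ is the set of cactus-tree pairs modulo the equivalence relation generated by expansions. Product: given two classes, choose representatives $(S_+,s,S_-)$, $(T_+,t,T_-)$ with $S_-=T_+$; the product is the class of $(S_+,st,T_-)$. The identity is the class of $(T,1,T)$ and the inverse of $(T_+,s,T_-)$ is $(T_-,s^{-1},T_+)$. Thompson's group $V$ is defined in the same way from tree pairs $(T_+,\sigma,T_-)$ with $\sigma\in S_n$: an expansion attaches a caret to leaf $i$ of $T_+$ and to leaf $\sigma(i)$ of $T_-$ and replaces $\sigma$ by the induced bijection of leaves (left child matched with left child, right child with right child, all other leaves matched as before). The map $\overline\pi:CV\to V$, $(T_+,s,T_-)\mapsto(T_+,\pi_n(s),T_-)$, is a surjective homomorphism, and the pure cactus Thompson group is $PCV:=\ker\overline\pi$. *)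

(* Defs.v *)
From HB Require Import structures.
From mathcomp Require Import all_boot generic_quotient fingroup perm zify.
From mathcomp Require Import boolp classical_sets cardinality.
From Stdlib Require Import Relation_Operators.

Set Implicit Arguments.
Unset Strict Implicit.
Unset Printing Implicit Defensive.

Local Open Scope quotient_scope.
Local Open Scope group_scope.

(* Leaves, strands and points are numbered from 0 (by 'I_n) instead of from 1.
   Every index formula below is invariant under this shift.
   Products of permutations compose from left to right: (s * t) m = t (s m). *)

Inductive bintree := Leaf | Node of bintree & bintree.

Fixpoint leaves (t : bintree) : nat :=
  if t is Node l r then leaves l + leaves r else 1.

Definition caret : bintree := Node Leaf Leaf.

(* Attaches a caret to leaf i of t, provided i < leaves t. *)
Fixpoint attach_caret (t : bintree) (i : nat) : bintree :=
  if t is Node l r then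
    if i < leaves l then Node (attach_caret l i) r
    else Node l (attach_caret r (i - leaves l))
  else caret.

Lemma leaves_attach_caret t i : leaves (attach_caret t i) = (leaves t).+1.
Proof.
elim: t i => //= l IHl r IHr i.
by case: ifP => _ /=; rewrite ?IHl ?IHr ?addSn ?addnS.
Qed.

(* B is obtained from A by attaching carets. *)
Fixpoint subtree (A B : bintree) : bool :=
  match A, B with
  | Leaf, _ => true
  | Node l r, Node l' r' => subtree l l' && subtree r r'
  | _, _ => false
  end.

Lemma leaves_gt0 t : 0 < leaves t.
Proof. by elim: t => //= l Hl r Hr; rewrite addn_gt0 Hl. Qed.

Lemma subtree_refl A : subtree A A.
Proof. by elim: A => //= l -> r ->. Qed.

Lemma subtree_leaves A B : subtree A B -> leaves A <= leaves B.
Proof.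
elim: A B => [|l IHl r IHr] [|l' r'] //= => [_|/andP[/IHl H1 /IHr H2]].
  by rewrite addn_gt0 leaves_gt0.
exact: leq_add.
Qed.

Lemma subtree_eq A B : subtree A B -> leaves A = leaves B -> A = B.
Proof.
elim: A B => [|l IHl r IHr] [|l' r'] //=.
  by move=> _; have := leaves_gt0 l'; have := leaves_gt0 r'; lia.
move=> /andP[sl sr] e; have := subtree_leaves sl; have := subtree_leaves sr.
by move=> H1 H2; congr Node; [apply: IHl|apply: IHr] => //; lia.
Qed.

Lemma subtree_step A B : subtree A B -> leaves A < leaves B ->
  exists2 i, i < leaves A & subtree (attach_caret A i) B.
Proof.
elim: A B => [|l IHl r IHr] [|l' r'] //=; first by exists 0.
move=> /andP[sl sr] e.
have [ltl|gel] := ltnP (leaves l) (leaves l').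
  have [i lti si] := IHl _ sl ltl; exists i; first by lia.
  by rewrite lti /= si.
have ltr : leaves r < leaves r' by lia.
have [i lti si] := IHr _ sr ltr; exists (leaves l + i); first by lia.
by rewrite ltnNge leq_addr /= addKn sl.
Qed.

Lemma subtree_attach2 A B i j : i < j -> j < leaves A ->
  subtree (attach_caret A i) B -> subtree (attach_caret A j) B ->
  subtree (attach_caret (attach_caret A i) j.+1) B.
Proof.
elim: A B i j => [|l IHl r IHr] [|l' r'] i j //=; try by lia.
- by case: ifP.
move=> ltij ltj; case: (ltnP i (leaves l)) => Hi; case: (ltnP j (leaves l)) => Hj /=;
  rewrite ?leaves_attach_caret.
- move=> /andP[s1 s2] /andP[s3 s4]; rewrite ltnS Hj /= s2 andbT; exact: IHl.
- by move=> /andP[s1 s2] /andP[s3 s4]; rewrite ltnS ltnNge Hj /= s1 /= subSS.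
- by lia.
move=> /andP[s1 s2] /andP[s3 s4]; rewrite ltnNge (leqW Hj) /= s1 /= subSn //.
by apply: IHr => //; lia.
Qed.

Lemma attach_caretC A i j : i < j -> j < leaves A ->
  attach_caret (attach_caret A i) j.+1 = attach_caret (attach_caret A j) i.
Proof.
elim: A i j => [|l IHl r IHr] i j //=; first by lia.
move=> ltij ltj; case: (ltnP i (leaves l)) => Hi; case: (ltnP j (leaves l)) => Hj /=;
  rewrite ?leaves_attach_caret.
- by rewrite ltnS Hj ltnS (ltnW Hi) IHl.
- by rewrite ltnS ltnNge Hj /= Hi subSS.
- by lia.
by rewrite !ltnNge Hi (leqW Hj) /= subSn // IHr //; lia.
Qed.

Lemma subtree_join A B : exists J, subtree A J && subtree B J.
Proof.
elim: A B => [|l IHl r IHr] B; first by exists B; rewrite subtree_refl.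
case: B => [|l' r']; first by exists (Node l r); rewrite subtree_refl.
have [J1 /andP[a b]] := IHl l'; have [J2 /andP[c d]] := IHr r'.
by exists (Node J1 J2); rewrite /= a b c d.
Qed.

(* If a caret is attached to leaf i, its children are the leaves lchild i and
   rchild i of the new tree; leaf m becomes lchild m if m < i, and rchild m if
   m > i. *)
Definition lchild n (i : 'I_n) : 'I_n.+1 := widen_ord (leqnSn n) i.
Definition rchild n (i : 'I_n) : 'I_n.+1 := lift ord0 i.

Definition tree n := {t : bintree | leaves t == n}.

Lemma attach_subproof n (t : tree n) (i : 'I_n) :
  leaves (attach_caret (val t) i) == n.+1.
Proof. by rewrite leaves_attach_caret eqSS (valP t). Qed.

Definition attach n (t : tree n) (i : 'I_n) : tree n.+1 :=
  exist _ (attach_caret (val t) i) (attach_subproof t i).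

Lemma leaf_subproof : leaves Leaf == 1%N. Proof. by []. Qed.
Definition leaf_tree : tree 1%N := exist _ Leaf leaf_subproof.

(* CV and V are obtained by the same construction from two families of groups
   acting on leaves.  Expanding (T_+, g, T_-) at leaf i turns g into clone i g.
   The permutation in perm_of_clone matches the right child of i with the right
   child of its image and all the remaining leaves of T'_+, among which the left
   child of i replaces i, as before. *)
Record cloning_system := CloningSystem {
  grp : nat -> groupType;
  perm_of : forall n, grp n -> 'S_n;
  clone : forall n, 'I_n -> grp n -> grp n.+1;
  perm_ofM : forall n (g h : grp n), perm_of (g * h) = perm_of g * perm_of h;
  cloneM : forall n (i : 'I_n) (g h : grp n),
    clone i (g * h) = clone i g * clone (perm_of g i) h;
  perm_of_clone : forall n (i : 'I_n) (g : grp n),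
    perm_of (clone i g) = lift_perm (rchild i) (rchild (perm_of g i)) (perm_of g);
  cloneC : forall n (i j : 'I_n) (g : grp n), i < j ->
    clone (rchild j) (clone i g) = clone (lchild i) (clone j g)
}.

Section TreePairs.

Variable c : cloning_system.

Record tree_pair := TreePair {
  psize : nat;
  upper : tree psize;
  middle : grp c psize;
  lower : tree psize
}.
Arguments TreePair {psize}.

HB.instance Definition _ := gen_eqMixin tree_pair.
HB.instance Definition _ := gen_choiceMixin tree_pair.

Definition expand (x : tree_pair) (i : 'I_(psize x)) : tree_pair :=
  TreePair (attach (upper x) i) (clone i (middle x))
           (attach (lower x) (perm_of (middle x) i)).

Definition expansion (x y : tree_pair) : Prop :=
  exists i : 'I_(psize x), y = expand i.

Definition pair_equiv : tree_pair -> tree_pair -> Prop :=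
  clos_refl_sym_trans tree_pair expansion.

(* Product of two tree pairs (S_+, s, S_-) and (T_+, t, T_-) with S_- = T_+. *)
Inductive composes : tree_pair -> tree_pair -> tree_pair -> Prop :=
  Composes n (A B C : tree n) (g h : grp c n) :
    composes (TreePair A g B) (TreePair B h C) (TreePair A (g * h) C).

Definition pair_inv (x : tree_pair) : tree_pair :=
  TreePair (lower x) (middle x)^-1 (upper x).

Let exps := clos_refl_trans_1n tree_pair expansion.
Let up x := val (upper x).
Let lo x := val (lower x).

Let perm_of1 n : perm_of (1 : grp c n) = 1.
Proof. by apply: (mulgI (perm_of (1 : grp c n))); rewrite -perm_ofM !mulg1. Qed.

Let perm_ofV n (g : grp c n) : perm_of g^-1 = (perm_of g)^-1.
Proof.
by apply: (mulgI (perm_of g)); rewrite -perm_ofM !mulgV perm_of1.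
Qed.

Let clone1 n (i : 'I_n) : clone i (1 : grp c n) = 1.
Proof.
apply: (mulgI (clone i (1 : grp c n))).
by rewrite -{2}[i]perm1 -perm_of1 -cloneM !mulg1.
Qed.

Let cloneV n (i : 'I_n) (g : grp c n) :
  clone (perm_of g i) g^-1 = (clone i g)^-1.
Proof. by apply: (mulgI (clone i g)); rewrite -cloneM !mulgV clone1. Qed.

Let leaves_up x : leaves (up x) = psize x.
Proof. exact/eqP/(valP (upper x)). Qed.

Let leaves_lo x : leaves (lo x) = psize x.
Proof. exact/eqP/(valP (lower x)). Qed.

Let expandC x (i j : 'I_(psize x)) : i < j ->
  expand (x := expand i) (rchild j) = expand (x := expand j) (lchild i).
Proof.
case: x i j => n A g B i j /= ltij.
have ne : perm_of g i != perm_of g j.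
  by rewrite (inj_eq perm_inj) -val_eqE /= ltn_eqF.
have Lj : rchild j = lift (rchild i) j.
  by apply: val_inj; rewrite /= /bump /=; lia.
have Li : lchild i = lift (rchild j) i.
  by apply: val_inj; rewrite /= /bump /=; lia.
have ltjA : j < leaves (val A) by rewrite (eqP (valP A)).
rewrite /expand /= cloneC //; congr TreePair.
  by apply: val_inj; exact: attach_caretC.
apply: val_inj; rewrite /= !perm_of_clone {1}Lj {1}Li !lift_perm_lift /=.
set a := perm_of g i in ne *; set b := perm_of g j in ne *.
have lta : a < leaves (val B) by rewrite (eqP (valP B)).
have ltb : b < leaves (val B) by rewrite (eqP (valP B)).
case: (ltngtP a b) => [ltab|ltba|/val_inj eab].
- have -> : bump (bump 0 a) b = b.+1 by rewrite /bump; lia.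
  have -> : bump (bump 0 b) a = a by rewrite /bump; lia.
  exact: attach_caretC.
- have -> : bump (bump 0 a) b = b by rewrite /bump; lia.
  have -> : bump (bump 0 b) a = a.+1 by rewrite /bump; lia.
  exact/esym/attach_caretC.
by rewrite eab eqxx in ne.
Qed.

Let exps_trans x y z : exps x y -> exps y z -> exps x z.
Proof.
elim=> // {}x u v xu _ IH vz; apply: rt1n_trans xu _; exact: IH.
Qed.

Let exps_size x y : exps x y -> psize x <= psize y.
Proof. by elim=> // {}x u v [i ->] _ /=; exact: ltnW. Qed.

Let exps_exist x U : subtree (up x) U -> exists2 y, exps x y & up y = U.
Proof.
have [k] := ubnP (leaves U - leaves (up x)); elim: k x => // k IH x ltk sx.
have [eq|ne] := eqVneq (leaves (up x)) (leaves U).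
  by exists x; [exact: rt1n_refl | exact: subtree_eq].
have lt : leaves (up x) < leaves U by rewrite ltn_neqAle ne subtree_leaves.
have [i] := subtree_step sx lt; rewrite leaves_up => lti si.
have ltk' : leaves U - leaves (up (expand (Ordinal lti))) < k.
  by move: ltk lt; rewrite /up /= leaves_attach_caret; lia.
have [y ey <-] := IH _ ltk' si.
by exists y => //; apply: rt1n_trans ey; exists (Ordinal lti).
Qed.

Let subtree_attach A i : subtree A (attach_caret A i).
Proof.
elim: A i => //= l IHl r IHr i.
by case: ifP => _ /=; rewrite ?IHl ?IHr ?subtree_refl.
Qed.

Let subtree_trans A B C : subtree A B -> subtree B C -> subtree A C.
Proof.
elim: A B C => [|l IHl r IHr] [|l' r'] [|l'' r''] //= /andP[a b] /andP[d e].
by rewrite (IHl _ _ a d) (IHr _ _ b e).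
Qed.

Let exps_subtree x y : exps x y -> subtree (up x) (up y).
Proof.
elim=> [{}x|{}x u v [i ->] _]; first exact: subtree_refl.
by apply: subtree_trans; exact: subtree_attach.
Qed.

Let exps_uniq x a b : exps x a -> exps x b -> up a = up b -> a = b.
Proof.
have [k] := ubnP (psize a - psize x).
elim: k x a b => // k IH x a b ltk xa xb eab.
have eqs : psize a = psize b by rewrite -!leaves_up eab.
case: xa ltk eab eqs => [|x1 {}a [i ->] x1a].
  case: xb => // x2 {}b [i ->] /exps_size /= ltb _ _ eb.
  by rewrite -eb ltnn in ltb.
case: xb => [|x2 {}b [j ->] x2b] ltk eab eqs.
  by have /= := exps_size x1a; rewrite eqs ltnn.
have sa := exps_size x1a; rewrite /= in sa.
wlog lij : i j a b ltk x1a x2b eab eqs sa / i < j => [H|].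
  case: (ltngtP i j) => [||/val_inj eij]; first exact: H.
    move=> lji; apply/esym; apply: (H j i) => //; rewrite -?eqs //.
  by subst j; apply: (IH (expand i)) => //=; move: ltk sa; clear; lia.
have ltj : j < leaves (up x) by rewrite leaves_up.
have /= sz : subtree (up (expand (x := expand i) (rchild j))) (up a).
  apply: subtree_attach2 => //; first exact: exps_subtree x1a.
  by rewrite eab; exact: exps_subtree x2b.
have [d zd ud] := exps_exist sz.
have sd : psize d = psize a by rewrite -!leaves_up ud.
transitivity d.
  apply: (IH (expand i)) => //=; first by move: ltk sa; clear; lia.
  by apply: rt1n_trans zd; exists (rchild j).
apply: (IH (expand j)) => //=; rewrite ?sd; first by move: ltk sa; clear; lia.
  by rewrite expandC // in zd; apply: rt1n_trans zd; exists (lchild i).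
by rewrite ud.
Qed.

Let exps_equiv x y : exps x y -> pair_equiv x y.
Proof.
elim=> [{}x|{}x u v xu _ IH]; first exact: rst_refl.
by apply: rst_trans IH; apply: rst_step.
Qed.

Let confluence x y : pair_equiv x y -> exists2 z, exps x z & exps y z.
Proof.
elim=> {x y} [x y xy|x|x y _ [z xz yz]|x y z _ [u xu yu] _ [v yv zv]].
- by exists y; [apply: rt1n_trans xy _|]; exact: rt1n_refl.
- by exists x; exact: rt1n_refl.
- by exists z.
have [J /andP[uJ vJ]] := subtree_join (up u) (up v).
have [u' uu' eu] := exps_exist uJ; have [v' vv' ev] := exps_exist vJ.
have e : u' = v'.
  by apply: (@exps_uniq y); [exact: exps_trans uu'|exact: exps_trans vv'|rewrite eu].
by exists u'; [exact: exps_trans uu'|rewrite e; exact: exps_trans vv'].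
Qed.

Let pair_invK : involutive pair_inv.
Proof. by case=> n A g B; rewrite /pair_inv /= invgK. Qed.

Let expansion_inv x y : expansion x y -> expansion (pair_inv x) (pair_inv y).
Proof.
case=> i ->; exists (perm_of (middle x) i : 'I_(psize (pair_inv x))).
by rewrite /expand /pair_inv /= cloneV perm_ofV permK.
Qed.

Let exps_inv x y : exps x y -> exps (pair_inv x) (pair_inv y).
Proof.
elim=> [{}x|{}x u v xu _ IH]; first exact: rt1n_refl.
by apply: rt1n_trans IH; exact: expansion_inv.
Qed.

Let equiv_inv x y : pair_equiv x y -> pair_equiv (pair_inv x) (pair_inv y).
Proof.
elim=> {x y} [x y xy|x|x y _ |x y z _ xy _ yz].
- by apply: rst_step; exact: expansion_inv.
- exact: rst_refl.
- exact: rst_sym.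
exact: rst_trans yz.
Qed.

Let composes_inv x y z :
  composes x y z -> composes (pair_inv y) (pair_inv x) (pair_inv z).
Proof. by case=> n A B C g h; rewrite /pair_inv /= invgM; constructor. Qed.

Let composes_lo x y z : composes x y z -> lo x = up y.
Proof. by case. Qed.

Let TreePair_inj n (A A' B B' : tree n) (g g' : grp c n) :
  TreePair A g B = TreePair A' g' B' -> [/\ A = A', g = g' & B = B'].
Proof.
move=> E.
have H (T : nat -> Type) (f : forall x, T (psize x)) :
    f (TreePair A g B) = f (TreePair A' g' B') :> T n.
  have : forall y (e : psize (TreePair A g B) = psize y), TreePair A g B = y ->
      ecast m (T m) e (f (TreePair A g B)) = f y.
    by move=> y e yE; subst y; rewrite eq_axiomK.
  by move=> K; exact: (K (TreePair A' g' B') (erefl n) E).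
split; [exact: (H _ upper) | exact: (H (fun m => grp c m) middle) |
        exact: (H _ lower)].
Qed.

Let composes_fun x y z z' : composes x y z -> composes x y z' -> z = z'.
Proof.
case=> n A B C g h H.
move: {-2}(TreePair A g B) {-2}(TreePair B h C) H (erefl (TreePair A g B))
      (erefl (TreePair B h C)) => x' y' [n' A' B' C' g' h'] e.
have en : n' = n by exact: (congr1 psize (esym e)).
by subst n'; move: e => /TreePair_inj[-> -> ->] /TreePair_inj[_ -> ->].
Qed.

Let composes_ex x y : lo x = up y -> exists z, composes x y z.
Proof.
move=> e; have en : psize x = psize y by rewrite -leaves_lo e leaves_up.
case: x y en e => n A g B [m B' h C] /= en; subst m.
by move=> /val_inj /= <-; exists (TreePair A (g * h) C); constructor.
Qed.

Let composes_expsl x y z x1 : composes x y z -> exps x x1 ->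
  exists y1 z1, [/\ exps y y1, exps z z1 & composes x1 y1 z1].
Proof.
move=> xyz xx1; elim: xx1 y z xyz => [{}x|{}x u v xu _ IH] y z xyz.
  by exists y, z; split=> //; exact: rt1n_refl.
have [y1 [z1 [yy1 zz1 c1]]] :
    exists y1 z1, [/\ expansion y y1, expansion z z1 & composes u y1 z1].
  clear IH; case: xu => i ->{u}; case: xyz i => n A B C g h /= i.
  exists (expand (x := TreePair B h C) (perm_of g i)),
    (expand (x := TreePair A (g * h) C) i); split; [by eexists|by eexists|].
  by rewrite /expand /= cloneM perm_ofM permM; constructor.
have [y2 [z2 [? ? ?]]] := IH _ _ c1.
by exists y2, z2; split=> //; apply: rt1n_trans; eassumption.
Qed.

Let composes_expsr x y z y1 : composes x y z -> exps y y1 ->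
  exists x1 z1, [/\ exps x x1, exps z z1 & composes x1 y1 z1].
Proof.
move=> /composes_inv xyz /exps_inv yy1.
have [x1 [z1 [/exps_inv + /exps_inv + /composes_inv]]] := composes_expsl xyz yy1.
by rewrite !pair_invK => *; exists (pair_inv x1), (pair_inv z1).
Qed.

Let exps_uniq_lo x a b : exps x a -> exps x b -> lo a = lo b -> a = b.
Proof.
move=> /exps_inv xa /exps_inv xb e.
by rewrite -[a]pair_invK -[b]pair_invK; congr pair_inv; exact: (exps_uniq xa xb e).
Qed.

Let composes_equiv x y z x' y' z' : composes x y z -> composes x' y' z' ->
  pair_equiv x x' -> pair_equiv y y' -> pair_equiv z z'.
Proof.
move=> xyz xyz' /confluence[X xX xX'] yy'.
have [y1 [z1 [yy1 zz1 c1]]] := composes_expsl xyz xX.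
have [y1' [z1' [yy1' zz1' c1']]] := composes_expsl xyz' xX'.
have /confluence[Y y1Y y1Y'] : pair_equiv y1 y1'.
  apply: rst_trans (exps_equiv yy1'); apply: rst_trans yy'.
  by apply: rst_sym; exact: exps_equiv.
have [X2 [z2 [XX2 zz2 c2]]] := composes_expsr c1 y1Y.
have [X2' [z2' [XX2' zz2' c2']]] := composes_expsr c1' y1Y'.
have e : X2 = X2'.
  by apply: (exps_uniq_lo XX2 XX2'); rewrite (composes_lo c2) (composes_lo c2').
move: c2'; rewrite -e => /(composes_fun c2) ez; subst z2'.
apply: (@rst_trans _ _ _ z2); first by apply: exps_equiv; exact: exps_trans zz2.
by apply: rst_sym; apply: exps_equiv; exact: exps_trans zz2'.
Qed.

Let equivb x y := `[< pair_equiv x y >].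

Lemma equivb_refl : reflexive equivb.
Proof. by move=> x; apply/asboolP; exact: rst_refl. Qed.

Lemma equivb_sym : symmetric equivb.
Proof. by move=> x y; apply: asbool_equiv_eq; split; exact: rst_sym. Qed.

Lemma equivb_trans : transitive equivb.
Proof.
by move=> y x z /asboolP xy /asboolP yz; apply/asboolP; exact: rst_trans yz.
Qed.

Definition pair_equiv_rel : equiv_rel tree_pair :=
  EquivRel (fun x y => `[< pair_equiv x y >]) equivb_refl equivb_sym equivb_trans.

Definition tree_pair_group : Type := {eq_quot pair_equiv_rel}.

HB.instance Definition _ := Choice.on tree_pair_group.
HB.instance Definition _ := EqQuotient.on tree_pair_group.

Let Q := tree_pair_group.

Definition pair_class (x : tree_pair) : Q := \pi_Q x.

Lemma pair_classP x y : pair_class x = pair_class y <-> pair_equiv x y.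
Proof. by split=> [/eqmodP/asboolP|xy] //; apply/eqmodP/asboolP. Qed.

Lemma pair_class_surj (u : Q) : exists x, pair_class x = u.
Proof. by exists (generic_quotient.repr u); exact: reprK. Qed.

Let common x y : exists X Y z, [/\ exps x X, exps y Y & composes X Y z].
Proof.
have [J /andP[xJ yJ]] := subtree_join (up (pair_inv x)) (up y).
have [X /exps_inv + eX] := exps_exist xJ; rewrite pair_invK => xX.
have [Y yY eY] := exps_exist yJ.
have [|z XYz] := @composes_ex (pair_inv X) Y; first by rewrite eY -eX.
by exists (pair_inv X), Y, z.
Qed.

Let composes_assoc x y z p q : composes x y p -> composes y z q ->
  exists2 r, composes p z r & composes x q r.
Proof.
case=> n A B C g h H.
move: {-2}(TreePair B h C) H (erefl (TreePair B h C)) => y' [m B' C' D h' k] e.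
have en : m = n by exact: (congr1 psize (esym e)).
subst m; move: e => /TreePair_inj[-> -> ->].
exists (TreePair A (g * h' * k) D); first by constructor.
by rewrite -mulgA; constructor.
Qed.

Let class_exps x y : exps x y -> pair_class x = pair_class y.
Proof. by move=> xy; apply/pair_classP; exact: exps_equiv. Qed.

Lemma class_mul_ex (u v : Q) : exists w : Q, exists x y z,
  [/\ u = pair_class x, v = pair_class y, w = pair_class z & composes x y z].
Proof.
have [x <-] := pair_class_surj u; have [y <-] := pair_class_surj v.
have [X [Y [z [xX yY XYz]]]] := common x y.
by exists (pair_class z), X, Y, z; split=> //; exact: class_exps.
Qed.

(* The product of two classes is the class of the product of any representatives
   (S_+, s, S_-) and (T_+, t, T_-) with S_- = T_+: see class_mulE. *)
Definition class_mul (u v : Q) : Q := projT1 (cid (class_mul_ex u v)).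

Definition class_one : Q := pair_class (TreePair leaf_tree 1 leaf_tree).

Definition class_inv (u : Q) : Q := pair_class (pair_inv (generic_quotient.repr u)).

Lemma class_mulE x y z : composes x y z ->
  class_mul (pair_class x) (pair_class y) = pair_class z.
Proof.
move=> xyz; rewrite /class_mul.
case: cid => w /= [x' [y' [z' [/pair_classP xx' /pair_classP yy' -> xyz']]]].
by apply/pair_classP; apply: composes_equiv xyz' xyz _ _; exact: rst_sym.
Qed.

Lemma class_invE x : class_inv (pair_class x) = pair_class (pair_inv x).
Proof.
by apply/pair_classP/equiv_inv/pair_classP; exact: (reprK (pair_class x)).
Qed.

Lemma class_oneE n (T : tree n) : class_one = pair_class (TreePair T 1 T).
Proof.
have [y + ey] := @exps_exist (TreePair leaf_tree 1 leaf_tree) (val T) isT.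
have H x : exps x y -> (exists m (S : tree m), x = TreePair S 1 S) ->
    exists m (S : tree m), y = TreePair S 1 S.
  elim=> // {}x u v [i ->] _ IH [m [S eS]]; apply: IH; move: eS i => -> /= i.
  by exists m.+1, (attach S i); rewrite /expand /= clone1 perm_of1 perm1.
move=> xy; have [|m [S eS]] := H _ xy; first by exists 1%N, leaf_tree.
apply/pair_classP/exps_equiv; move: eS ey xy => -> {y H}; rewrite /up /= => eS.
have em : m = n by rewrite -(eqP (valP S)) -(eqP (valP T)) /= eS.
by subst m; rewrite (val_inj eS).
Qed.

Lemma class_mulA : associative class_mul.
Proof.
move=> u v w.
have [x <-] := pair_class_surj u; have [y <-] := pair_class_surj v.
have [z <-] := pair_class_surj w.
have [Y0 [Z0 [p0 [/class_exps-> /class_exps-> YZ0]]]] := common y z.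
have [X [Y [p [/class_exps-> YY XYp]]]] := common x Y0.
have [Z [q [/class_exps-> _ YZq]]] := composes_expsl YZ0 YY.
have [r pZr Xqr] := composes_assoc XYp YZq; rewrite (class_exps YY).
by rewrite (class_mulE XYp) (class_mulE YZq) (class_mulE pZr) (class_mulE Xqr).
Qed.

Lemma class_mul1g : left_id class_one class_mul.
Proof.
move=> u; have [[n A g B] <-] := pair_class_surj u.
rewrite (class_oneE A); apply: class_mulE.
by rewrite -{2}[g]mul1g; constructor.
Qed.

Lemma class_mulg1 : right_id class_one class_mul.
Proof.
move=> u; have [[n A g B] <-] := pair_class_surj u.
rewrite (class_oneE B); apply: class_mulE.
by rewrite -{2}[g]mulg1; constructor.
Qed.

Lemma class_mulVg : left_inverse class_one class_inv class_mul.
Proof.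
move=> u; have [[n A g B] <-] := pair_class_surj u.
rewrite class_invE (class_oneE B); apply: class_mulE.
by rewrite -(mulVg g); constructor.
Qed.

Lemma class_mulgV : right_inverse class_one class_inv class_mul.
Proof.
move=> u; have [[n A g B] <-] := pair_class_surj u.
rewrite class_invE (class_oneE A); apply: class_mulE.
by rewrite -(mulgV g); constructor.
Qed.

HB.instance Definition _ := isGroup.Build tree_pair_group
  class_mulA class_mul1g class_mulg1 class_mulVg class_mulgV.

End TreePairs.

Arguments TreePair {c psize}.

(* The generator s_{i,j} of J_n is the pair i < j. *)
Definition gen n := {ij : 'I_n * 'I_n | ij.1 < ij.2}.

Definition mkgen n (i j : 'I_n) (ltij : i < j) : gen n := exist _ (i, j) ltij.
Definition glo n (s : gen n) : 'I_n := (val s).1.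
Definition ghi n (s : gen n) : 'I_n := (val s).2.

Inductive cactus_rel n : seq (gen n) -> seq (gen n) -> Prop :=
| CactusInv s : cactus_rel [:: s; s] [::]
| CactusComm s t : ghi s < glo t -> cactus_rel [:: s; t] [:: t; s]
| CactusNest s t u : glo s <= glo t -> ghi t <= ghi s ->
    glo u = glo s + ghi s - ghi t :> nat ->
    ghi u = glo s + ghi s - glo t :> nat ->
    cactus_rel [:: s; t] [:: u; s].

(* As the generators are involutions, every element of J_n is represented by a
   positive word, and J_n is the quotient of the free monoid on the generators
   by the congruence generated by the relations. *)
Definition cactus_step n (v w : seq (gen n)) : Prop :=
  exists a b x y, [/\ v = a ++ x ++ b, w = a ++ y ++ b & cactus_rel x y].

Definition cactus_equiv n : seq (gen n) -> seq (gen n) -> Prop :=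
  clos_refl_sym_trans _ (@cactus_step n).

Section CactusGroup.

Variable n : nat.
Implicit Types (s : gen n) (v w a b : seq (gen n)).

Let equivb (v w : seq (gen n)) := `[< cactus_equiv v w >].

Lemma cactusb_refl : reflexive equivb.
Proof. by move=> x; apply/asboolP; exact: rst_refl. Qed.

Lemma cactusb_sym : symmetric equivb.
Proof. by move=> x y; apply: asbool_equiv_eq; split; exact: rst_sym. Qed.

Lemma cactusb_trans : transitive equivb.
Proof.
by move=> y x z /asboolP xy /asboolP yz; apply/asboolP; exact: rst_trans yz.
Qed.

Definition cactus_equiv_rel : equiv_rel (seq (gen n)) :=
  EquivRel (fun v w => `[< cactus_equiv v w >])
    cactusb_refl cactusb_sym cactusb_trans.

Definition cactus : Type := {eq_quot cactus_equiv_rel}.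

HB.instance Definition _ := Choice.on cactus.
HB.instance Definition _ := EqQuotient.on cactus.

Definition cactus_class (w : seq (gen n)) : cactus := \pi_cactus w.

Definition cactus_word (g : cactus) : seq (gen n) := generic_quotient.repr g.

Lemma cactus_wordK g : cactus_class (cactus_word g) = g.
Proof. exact: reprK. Qed.

Lemma cactus_classP v w : cactus_class v = cactus_class w <-> cactus_equiv v w.
Proof. by split=> [/eqmodP/asboolP|vw] //; apply/eqmodP/asboolP. Qed.

Lemma cactus_equiv_cat a b v w :
  cactus_equiv v w -> cactus_equiv (a ++ v ++ b) (a ++ w ++ b).
Proof.
elim=> {v w} [v w [a' [b' [x [y [-> -> xy]]]]]|v|v w _|v w x _ vw _ wx].
- apply: rst_step; exists (a ++ a'), (b' ++ b), x, y.
  by rewrite !catA.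
- exact: rst_refl.
- exact: rst_sym.
exact: rst_trans wx.
Qed.

Lemma cactus_rel_rev (v w : seq (gen n)) :
  cactus_rel v w -> cactus_equiv (rev v) (rev w).
Proof.
have sq (s : gen n) a b : cactus_equiv (a ++ b) (a ++ [:: s; s] ++ b).
  by apply: rst_sym; apply: rst_step; exists a, b, [:: s; s], [::]; split=> //; constructor.
case=> [s|s t st|s t u st ts eu1 eu2]; rewrite /rev /=.
- exact: (rst_sym _ _ _ _ (sq s [::] [::])).
- apply: rst_sym; apply: rst_step.
  by exists [::], [::], [:: s; t], [:: t; s]; split=> //; constructor.
(* t s = s (s t) s = s u s s = s u *)
apply: (@rst_trans _ _ _ ([:: s; s; t; s])); first exact: (sq s [::]).
apply: (@rst_trans _ _ _ ([:: s; u; s; s])).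
  apply: rst_step; exists [:: s], [:: s], [:: s; t], [:: u; s].
  by split=> //; constructor.
by apply: rst_sym; exact: (sq s [:: s; u] [::]).
Qed.

Definition cactus_mul (g h : cactus) : cactus :=
  cactus_class (cactus_word g ++ cactus_word h).
Definition cactus_one : cactus := cactus_class [::].
Definition cactus_inv (g : cactus) : cactus :=
  cactus_class (rev (cactus_word g)).

Lemma cactus_mulE v w :
  cactus_mul (cactus_class v) (cactus_class w) = cactus_class (v ++ w).
Proof.
apply/cactus_classP; apply: (@rst_trans _ _ _ (v ++ cactus_word (cactus_class w))).
  by apply: (@cactus_equiv_cat [::]); apply/cactus_classP; exact: cactus_wordK.
have /(@cactus_equiv_cat v [::]) :
  cactus_equiv (cactus_word (cactus_class w)) w by apply/cactus_classP/cactus_wordK.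
by rewrite !cats0.
Qed.

Lemma cactus_equiv_rev v w : cactus_equiv v w -> cactus_equiv (rev v) (rev w).
Proof.
elim=> {v w} [v w [a [b [x [y [-> -> xy]]]]]|v|v w _|v w x _ vw _ wx].
- by rewrite !rev_cat -!catA; apply: cactus_equiv_cat; exact: cactus_rel_rev.
- exact: rst_refl.
- exact: rst_sym.
exact: rst_trans wx.
Qed.

Lemma cactus_invE w : cactus_inv (cactus_class w) = cactus_class (rev w).
Proof. exact/cactus_classP/cactus_equiv_rev/cactus_classP/cactus_wordK. Qed.

Lemma cactus_mulA : associative cactus_mul.
Proof.
move=> g h k; rewrite -[g]cactus_wordK -[h]cactus_wordK -[k]cactus_wordK.
by rewrite !cactus_mulE catA.
Qed.

Lemma cactus_mul1g : left_id cactus_one cactus_mul.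
Proof. by move=> g; rewrite -[g]cactus_wordK cactus_mulE. Qed.

Lemma cactus_mulg1 : right_id cactus_one cactus_mul.
Proof. by move=> g; rewrite -[g]cactus_wordK cactus_mulE cats0. Qed.

Lemma cactus_mulVg : left_inverse cactus_one cactus_inv cactus_mul.
Proof.
move=> g; rewrite -[g]cactus_wordK cactus_invE cactus_mulE.
apply/cactus_classP; elim: (cactus_word g) => [|s w IH]; first exact: rst_refl.
apply: rst_trans IH; apply: rst_step.
exists (rev w), w, [:: s; s], [::]; split=> //; last by constructor.
by rewrite rev_cons cat_rcons.
Qed.

Lemma cactus_mulgV : right_inverse cactus_one cactus_inv cactus_mul.
Proof.
move=> g; rewrite -[g]cactus_wordK cactus_invE cactus_mulE -{1}[cactus_word g]revK.
apply/cactus_classP; elim: (rev (cactus_word g)) => [|s w IH]; first exact: rst_refl.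
apply: rst_trans IH; apply: rst_step.
exists (rev w), w, [:: s; s], [::]; split=> //; last by constructor.
by rewrite rev_cons cat_rcons.
Qed.

HB.instance Definition _ := isGroup.Build cactus
  cactus_mulA cactus_mul1g cactus_mulg1 cactus_mulVg cactus_mulgV.

Lemma cactus_classM v w : cactus_class (v ++ w) = cactus_class v * cactus_class w.
Proof. by rewrite -cactus_mulE. Qed.

Lemma cactus_class_rel v w : cactus_rel v w -> cactus_class v = cactus_class w.
Proof.
move=> vw; apply/cactus_classP; apply: rst_step.
by exists [::], [::], v, w; rewrite !cats0.
Qed.

(* Functions on words which respect the relations factor through J_n. *)
Lemma cactus_lift (T : Type) (f : seq (gen n) -> T) :
  (forall a b x y, cactus_rel x y -> f (a ++ x ++ b) = f (a ++ y ++ b)) ->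
  forall w, f (cactus_word (cactus_class w)) = f w.
Proof.
move=> fE w; have: cactus_equiv (cactus_word (cactus_class w)) w.
  by apply/cactus_classP/cactus_wordK.
move: (cactus_word _) => v; elim=> {v w} // [v w [a [b [x [y [-> -> xy]]]]]|v w x _ -> _ ->] //.
exact: fE.
Qed.

(* The permutation m |-> i + j - m of [i, j] underlying s_{i,j}. *)
Definition flip_fun (s : gen n) (m : 'I_n) : 'I_n :=
  if glo s <= m <= ghi s then insubd m (glo s + ghi s - m) else m.

Lemma flip_funE s m :
  flip_fun s m = (if glo s <= m <= ghi s then glo s + ghi s - m else m) :> nat.
Proof.
rewrite /flip_fun; case: ifP => // /andP[ilo ihi]; rewrite val_insubd.
by case: ifP => //; have := ltn_ord (ghi s); lia.
Qed.

Lemma flip_funK s : involutive (flip_fun s).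
Proof.
move=> m; apply: val_inj; rewrite /= !flip_funE.
by do !case: ifP; lia.
Qed.

Definition flip (s : gen n) : 'S_n := perm (can_inj (flip_funK s)).

Lemma flipE s m :
  flip s m = (if glo s <= m <= ghi s then glo s + ghi s - m else m) :> nat.
Proof. by rewrite permE flip_funE. Qed.

Fixpoint word_perm (w : seq (gen n)) : 'S_n :=
  if w is s :: w' then flip s * word_perm w' else 1.

Lemma word_perm_cat v w : word_perm (v ++ w) = word_perm v * word_perm w.
Proof. by elim: v => [|s v IH] /=; rewrite ?mul1g // IH mulgA. Qed.

Lemma glo_lt_ghi (s : gen n) : glo s < ghi s. Proof. exact: (valP s). Qed.

Lemma word_perm_rel v w : cactus_rel v w -> word_perm v = word_perm w.
Proof.
have L := glo_lt_ghi.
case=> [s|s t st|s t u st ts e1 e2] /=; rewrite !mulg1; apply/permP=> m;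
  apply: val_inj; rewrite !permM ?perm1 /= !flipE.
- by move: (L s); do !case: ifP; lia.
- by move: (L s) (L t); do !case: ifP; lia.
by rewrite e1 e2; move: (L s) (L t); do !case: ifP; lia.
Qed.

Definition cactus_perm (g : cactus) : 'S_n := word_perm (cactus_word g).

Lemma cactus_permE w : cactus_perm (cactus_class w) = word_perm w.
Proof.
apply: (cactus_lift (f := word_perm)) => a b x y xy.
by rewrite !word_perm_cat (word_perm_rel xy).
Qed.

Lemma cactus_permM g h : cactus_perm (g * h) = cactus_perm g * cactus_perm h.
Proof. by rewrite [g * h]/(cactus_mul g h) cactus_permE word_perm_cat. Qed.

End CactusGroup.

Section CactusClone.

Variable n : nat.
Implicit Types (i : 'I_n) (s t : gen n).

Lemma lchild_lt_lchild s : lchild (glo s) < lchild (ghi s).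
Proof. exact: glo_lt_ghi. Qed.
Lemma rchild_lt_rchild s : rchild (glo s) < rchild (ghi s).
Proof. exact: glo_lt_ghi. Qed.
Lemma lchild_lt_rchild s : lchild (glo s) < rchild (ghi s).
Proof. exact/leqW/glo_lt_ghi. Qed.
Lemma caret_lt i : lchild i < rchild i.
Proof. exact: leqnn. Qed.

(* The subword s'_m of s' obtained from the letter s = s_{j,k} with i = p_m. *)
Definition clone_gen (i : 'I_n) (s : gen n) : seq (gen n.+1) :=
  if ghi s < i then [:: mkgen (lchild_lt_lchild s)]
  else if i < glo s then [:: mkgen (rchild_lt_rchild s)]
  else [:: mkgen (caret_lt i); mkgen (lchild_lt_rchild s)].

Fixpoint clone_word (i : 'I_n) (w : seq (gen n)) : seq (gen n.+1) :=
  if w is s :: w' then clone_gen i s ++ clone_word (flip s i) w' else [::].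

Definition cactus_clone (i : 'I_n) (g : cactus n) : cactus n.+1 :=
  cactus_class (clone_word i (cactus_word g)).

Lemma clone_word_cat i v w :
  clone_word i (v ++ w) = clone_word i v ++ clone_word (word_perm v i) w.
Proof. by elim: v i => [|s v IH] i /=; rewrite ?perm1 // IH permM catA. Qed.

End CactusClone.

Section CactusCompute.

(* s_{i,j} with indices in nat, and 1 outside of the range. *)
Let sN n (i j : nat) : cactus n :=
  if insub i is Some i' then if insub j is Some j' then
  if insub (i', j') is Some s then cactus_class [:: (s : gen n)] else 1 else 1 else 1.

Let sN_gen n (s : gen n) : cactus_class [:: s] = sN n (glo s) (ghi s).
Proof.
rewrite /sN !valK; case: insubP => [t _ e|]; last by rewrite (valP s).
by congr cactus_class; congr cons; apply: val_inj; rewrite e; exact: surjective_pairing.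
Qed.

Let sNP n i j : i < j < n ->
  exists s : gen n, [/\ sN n i j = cactus_class [:: s], glo s = i :> nat & ghi s = j :> nat].
Proof.
move=> /andP[ij jn]; have ltin := ltn_trans ij jn.
exists (@mkgen n (Ordinal ltin) (Ordinal jn) ij); split=> //.
Qed.

Let sN1 n i j : ~~ (i < j < n) -> sN n i j = 1.
Proof.
rewrite /sN; case: insubP => // i' _ <-; case: insubP => // j' _ <-.
by case: insubP => //= s h _; rewrite h ltn_ord.
Qed.

Let sNK n i j : sN n i j * sN n i j = 1.
Proof.
case: (boolP (i < j < n)) => [/sNP[s [-> _ _]]|/sN1->]; last by rewrite mulg1.
by rewrite -cactus_classM; apply: cactus_class_rel; constructor.
Qed.

Let sNC n i j k l : j < k -> sN n i j * sN n k l = sN n k l * sN n i j.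
Proof.
move=> jk.
case: (boolP (i < j < n)) => [/sNP[s [-> _ es]]|/sN1->]; last by rewrite mulg1 mul1g.
case: (boolP (k < l < n)) => [/sNP[t [-> et _]]|/sN1->]; last by rewrite mulg1 mul1g.
by rewrite -!cactus_classM; apply: cactus_class_rel; constructor; rewrite es et.
Qed.

Let sNN n i j k l k' l' : i <= k -> k < l -> l <= j -> j < n ->
  k' = (i + j - l)%N -> l' = (i + j - k)%N ->
  sN n i j * sN n k l = sN n k' l' * sN n i j.
Proof.
move=> ik kl lj jn ek el.
have /sNP[s [-> s1 s2]] : i < j < n by lia.
have /sNP[t [-> t1 t2]] : k < l < n by lia.
have /sNP[u [-> u1 u2]] : k' < l' < n by lia.
by rewrite -!cactus_classM; apply: cactus_class_rel; constructor; lia.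
Qed.

Let cg n (p i j : nat) : cactus n :=
  if j < p then sN n i j else if p < i then sN n i.+1 j.+1
  else sN n p p.+1 * sN n i j.+1.

Let fl (i j p : nat) := if i <= p <= j then (i + j - p)%N else p.

Let clone_genE n (i : 'I_n) (s : gen n) :
  cactus_class (clone_gen i s) = cg n.+1 i (glo s) (ghi s).
Proof.
rewrite /clone_gen /cg; case: ifP => _; first exact: sN_gen.
case: ifP => _; first exact: sN_gen.
by rewrite -[in LHS]cat1s cactus_classM !sN_gen.
Qed.

Let cg_low n p i j : j < p -> cg n p i j = sN n i j.
Proof. by rewrite /cg => ->. Qed.
Let cg_high n p i j : p < i -> i < j -> cg n p i j = sN n i.+1 j.+1.
Proof. by rewrite /cg => pi ij; rewrite pi ifN //; lia. Qed.
Let cg_in n p i j : i <= p -> p <= j -> cg n p i j = sN n p p.+1 * sN n i j.+1.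
Proof. by rewrite /cg => pi ij; rewrite !ifN //; lia. Qed.
Let fl_in i j p : i <= p -> p <= j -> fl i j p = (i + j - p)%N.
Proof. by rewrite /fl => -> ->. Qed.
Let fl_out i j p : (p < i) || (j < p) -> fl i j p = p.
Proof. by rewrite /fl => h; rewrite ifN //; lia. Qed.

Let cgK n p i j : i < j -> j < n -> p < n ->
  cg n.+1 p i j * cg n.+1 (fl i j p) i j = 1.
Proof.
move=> ij jn pn; case: (ltnP j p) => [jp|pj].
  by rewrite fl_out ?jp ?orbT // cg_low // sNK.
case: (ltnP p i) => [pi|ip]; first by rewrite fl_out ?pi // cg_high // sNK.
rewrite fl_in // !cg_in //; try lia.
set q := (i + j - p)%N.
have e1 : sN n.+1 i j.+1 * sN n.+1 q q.+1 = sN n.+1 p p.+1 * sN n.+1 i j.+1.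
  by apply: sNN; lia.
by rewrite mulgA -[X in X * _]mulgA e1 mulgA sNK mul1g sNK.
Qed.

Let cgC n p i j k l : i < j -> j < k -> k < l -> l < n -> p < n ->
  cg n.+1 p i j * cg n.+1 (fl i j p) k l = cg n.+1 p k l * cg n.+1 (fl k l p) i j.
Proof.
move=> ij jk kl ln pn; case: (ltnP j p) => [jp|pj].
  rewrite [fl i j p]fl_out ?jp ?orbT // cg_low //.
  case: (ltnP l p) => [lp|pl].
    by rewrite fl_out ?lp ?orbT // !cg_low // sNC.
  case: (ltnP p k) => [pk|kp].
    by rewrite fl_out ?pk // cg_high // cg_low // sNC //; lia.
  rewrite fl_in // cg_in // cg_low; last by lia.
  have e1 : sN n.+1 i j * sN n.+1 p p.+1 = sN n.+1 p p.+1 * sN n.+1 i j.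
    by apply: sNC; lia.
  have e2 : sN n.+1 i j * sN n.+1 k l.+1 = sN n.+1 k l.+1 * sN n.+1 i j.
    by apply: sNC; lia.
  by rewrite mulgA e1 -mulgA e2 mulgA.
rewrite [fl k l p]fl_out; last by lia.
case: (ltnP p i) => [pi|ip].
  rewrite [fl i j p]fl_out ?pi // !cg_high; try lia.
  by apply: sNC; lia.
rewrite [fl i j p]fl_in // [cg _ (_ - _) k l]cg_high; [|lia|lia].
rewrite [cg _ p k l]cg_high; [|lia|lia]; rewrite cg_in //.
have e1 : sN n.+1 p p.+1 * sN n.+1 k.+1 l.+1 = sN n.+1 k.+1 l.+1 * sN n.+1 p p.+1.
  by apply: sNC; lia.
have e2 : sN n.+1 i j.+1 * sN n.+1 k.+1 l.+1 = sN n.+1 k.+1 l.+1 * sN n.+1 i j.+1.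
  by apply: sNC; lia.
by rewrite -mulgA e2 mulgA e1 mulgA.
Qed.

Let cgN n p i j k l k' l' : i <= k -> k < l -> l <= j -> j < n -> p < n ->
  k' = (i + j - l)%N -> l' = (i + j - k)%N ->
  cg n.+1 p i j * cg n.+1 (fl i j p) k l = cg n.+1 p k' l' * cg n.+1 (fl k' l' p) i j.
Proof.
move=> ik kl lj jn pn ek el; case: (ltnP j p) => [jp|pj].
  rewrite !fl_out ?cg_low; try lia.
  by apply: sNN => //; lia.
case: (ltnP p i) => [pi|ip].
  rewrite !fl_out ?cg_high; try lia.
  by apply: sNN => //; lia.
rewrite [fl i j p]fl_in // [cg _ p i j]cg_in //.
case: (ltnP p k') => [pk'|k'p].
  rewrite [fl k' l' p]fl_out ?pk' // [cg _ p i j]cg_in //.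
  rewrite [cg _ (_ - _) k l]cg_low; last by lia.
  rewrite [cg _ p k' l']cg_high; [|lia|lia].
  have e1 : sN n.+1 i j.+1 * sN n.+1 k l = sN n.+1 k'.+1 l'.+1 * sN n.+1 i j.+1.
    by apply: sNN; lia.
  have e2 : sN n.+1 p p.+1 * sN n.+1 k'.+1 l'.+1 = sN n.+1 k'.+1 l'.+1 * sN n.+1 p p.+1.
    by apply: sNC; lia.
  by rewrite -mulgA e1 mulgA e2 mulgA.
case: (ltnP l' p) => [l'p|pl'].
  rewrite [fl k' l' p]fl_out ?l'p ?orbT // [cg _ p i j]cg_in //.
  rewrite [cg _ (_ - _) k l]cg_high; [|lia|lia].
  rewrite [cg _ p k' l']cg_low; last by lia.
  have e1 : sN n.+1 i j.+1 * sN n.+1 k.+1 l.+1 = sN n.+1 k' l' * sN n.+1 i j.+1.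
    by apply: sNN; lia.
  have e2 : sN n.+1 k' l' * sN n.+1 p p.+1 = sN n.+1 p p.+1 * sN n.+1 k' l'.
    by apply: sNC; lia.
  by rewrite -mulgA e1 mulgA -e2 mulgA.
rewrite [fl k' l' p]fl_in // !cg_in; try lia.
set q := (i + j - p)%N; set r := (k' + l' - p)%N.
have e1 : sN n.+1 i j.+1 * sN n.+1 q q.+1 = sN n.+1 p p.+1 * sN n.+1 i j.+1.
  by apply: sNN; lia.
have e2 : sN n.+1 k' l'.+1 * sN n.+1 r r.+1 = sN n.+1 p p.+1 * sN n.+1 k' l'.+1.
  by apply: sNN; lia.
have e3 : sN n.+1 i j.+1 * sN n.+1 k l.+1 = sN n.+1 k' l'.+1 * sN n.+1 i j.+1.
  by apply: sNN; lia.
rewrite [LHS]mulgA -[X in X * _ = _]mulgA e1 mulgA sNK mul1g e3.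
by rewrite [RHS]mulgA -[X in _ = X * _]mulgA e2 mulgA sNK mul1g.
Qed.

Let flip_fl n (s : gen n) (i : 'I_n) : flip s i = fl (glo s) (ghi s) i :> nat.
Proof. exact: flipE. Qed.

Lemma cactus_cloneE n (i : 'I_n) (w : seq (gen n)) :
  cactus_clone i (cactus_class w) = cactus_class (clone_word i w).
Proof.
apply: (cactus_lift (f := fun w => cactus_class (clone_word i w))) => a b x y xy.
rewrite !clone_word_cat (word_perm_rel xy) !cactus_classM.
congr (_ * (_ * _)); move: (word_perm a i) => {a b w}i.
have L := @glo_lt_ghi n; have O := @ltn_ord n.
case: xy => [s|s t st|s t u st ts e1 e2] /=; rewrite !cats0 !cactus_classM !clone_genE !flip_fl.
- exact: cgK.
- exact: cgC.
exact: cgN.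
Qed.

Lemma cactus_cloneM n (i : 'I_n) (g h : cactus n) :
  cactus_clone i (g * h) = cactus_clone i g * cactus_clone (cactus_perm g i) h.
Proof.
rewrite [g * h]/(cactus_mul g h) cactus_cloneE clone_word_cat cactus_classM.
by [].
Qed.

Let clone_gen_perm n (i : 'I_n) (s : gen n) :
  word_perm (clone_gen i s) = lift_perm (rchild i) (rchild (flip s i)) (flip s).
Proof.
have L := glo_lt_ghi s.
apply/permP=> m; apply: val_inj; case: (unliftP (rchild i) m) => [k|] ->.
  rewrite lift_perm_lift /clone_gen; case: ifP => [h|/negbT h]; last case: ifP => [h'|/negbT h'];
    rewrite /= !permM perm1 /= !flipE /= /bump /= ?flipE;
    by do !case: ifP; lia.
rewrite lift_perm_id /clone_gen; case: ifP => [h|/negbT h]; last case: ifP => [h'|/negbT h'];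
  rewrite /= !permM perm1 /= !flipE /= /bump /= ?flipE;
  by do !case: ifP; lia.
Qed.

Lemma cactus_perm_clone n (i : 'I_n) (g : cactus n) :
  cactus_perm (cactus_clone i g) =
  lift_perm (rchild i) (rchild (cactus_perm g i)) (cactus_perm g).
Proof.
rewrite cactus_permE /cactus_perm; elim: (cactus_word g) i => [|s w IH] i /=.
  by rewrite perm1 lift_perm1.
by rewrite word_perm_cat IH clone_gen_perm lift_permM permM.
Qed.

Let clone_sN n (p : 'I_n) a b : a < b < n ->
  cactus_clone p (sN n a b) = cg n.+1 p a b.
Proof.
by move=> /sNP[s [-> <- <-]]; rewrite cactus_cloneE /= cats0 clone_genE.
Qed.

Let perm_sN n (p : 'I_n) a b : a < b < n ->
  cactus_perm (sN n a b) p = fl a b p :> nat.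
Proof.
by move=> /sNP[s [-> <- <-]]; rewrite cactus_permE /= mulg1 flip_fl.
Qed.

Let clone_sN2 n (p : 'I_n) a b a' b' : a < b < n -> a' < b' < n ->
  cactus_clone p (sN n a b * sN n a' b') =
  cg n.+1 p a b * cg n.+1 (fl a b p) a' b'.
Proof. by move=> ab ab'; rewrite cactus_cloneM !clone_sN // perm_sN. Qed.

Let clone_genC n (i j : 'I_n) (s : gen n) : i < j ->
  cactus_clone (rchild j) (cactus_class (clone_gen i s)) =
  cactus_clone (lchild i) (cactus_class (clone_gen j s)).
Proof.
move=> ij; rewrite !clone_genE.
have jn := ltn_ord j; have bn := ltn_ord (ghi s); have ab := glo_lt_ghi s.
have vi : lchild i = i :> nat by [].
have vj : rchild j = j.+1 :> nat by [].
move: (nat_of_ord (glo s)) (nat_of_ord (ghi s)) bn ab => a b bn ab.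
case: (ltnP b i) => [bi|ib].
  rewrite [cg _ i a b]cg_low // [cg _ j a b]cg_low; last by lia.
  rewrite !clone_sN; try lia.
  by rewrite vi vj !cg_low //; lia.
case: (ltnP i a) => [ia|ai].
  rewrite [cg _ i a b]cg_high // clone_sN; last by lia.
  rewrite vj; case: (ltnP b j) => [bj|jb].
    rewrite [cg _ j a b]cg_low // clone_sN; last by lia.
    by rewrite vi cg_low // cg_high.
  case: (ltnP j a) => [ja|aj].
    rewrite [cg _ j a b]cg_high // clone_sN; last by lia.
    by rewrite vi !cg_high //; lia.
  rewrite [cg _ j a b]cg_in // clone_sN2; try lia.
  by rewrite vi fl_out ?ij // cg_in // !cg_high //; lia.
rewrite [cg _ i a b]cg_in // clone_sN2; try lia.
rewrite vj [fl i _ _]fl_out; last by lia.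
rewrite [cg _ j.+1 i i.+1]cg_low; last by lia.
case: (ltnP b j) => [bj|jb].
  rewrite [cg _ j a b]cg_low // clone_sN; last by lia.
  by rewrite vi cg_low // cg_in.
rewrite [cg _ j a b]cg_in; try lia.
rewrite clone_sN2; try lia.
rewrite vi [fl j _ _]fl_out ?ij // [cg _ i j _]cg_high // !cg_in; try lia.
by rewrite !mulgA sNC.
Qed.

Lemma cactus_cloneC n (i j : 'I_n) (g : cactus n) : i < j ->
  cactus_clone (rchild j) (cactus_clone i g) =
  cactus_clone (lchild i) (cactus_clone j g).
Proof.
rewrite -[g]cactus_wordK; elim: (cactus_word g) i j => [|s w IH] i j ij.
  by rewrite !cactus_cloneE.
rewrite -cat1s cactus_classM !cactus_cloneM.
have cE k : cactus_clone k (cactus_class [:: s]) = cactus_class (clone_gen k s).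
  by rewrite cactus_cloneE /= cats0.
rewrite !cE clone_genC // !cactus_permE /= !mulg1 !clone_gen_perm.
congr (_ * _).
have ne : flip s i != flip s j by rewrite (inj_eq perm_inj) -val_eqE /= ltn_eqF.
have {1}-> : rchild j = lift (rchild i) j.
  by apply: val_inj; rewrite /= /bump /=; lia.
have {1}-> : lchild i = lift (rchild j) i.
  by apply: val_inj; rewrite /= /bump /=; lia.
rewrite !lift_perm_lift; move: (flip s i) (flip s j) ne => a b ne.
case: (ltngtP a b) => [ltab|ltba|/val_inj eab].
- have -> : lift (rchild a) b = rchild b.
    by apply: val_inj; rewrite /= /bump /=; lia.
  have -> : lift (rchild b) a = lchild a.
    by apply: val_inj; rewrite /= /bump /=; lia.
  exact: IH.
- have -> : lift (rchild a) b = lchild b.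
    by apply: val_inj; rewrite /= /bump /=; lia.
  have -> : lift (rchild b) a = rchild a.
    by apply: val_inj; rewrite /= /bump /=; lia.
  exact/esym/IH.
by rewrite eab eqxx in ne.
Qed.

End CactusCompute.

Definition perm_clone n (i : 'I_n) (g : 'S_n) : 'S_n.+1 :=
  lift_perm (rchild i) (rchild (g i)) g.

Lemma perm_cloneM n (i : 'I_n) (g h : 'S_n) :
  perm_clone i (g * h) = perm_clone i g * perm_clone (g i) h.
Proof. by rewrite /perm_clone lift_permM permM. Qed.

Lemma perm_cloneC n (i j : 'I_n) (g : 'S_n) : i < j ->
  perm_clone (rchild j) (perm_clone i g) = perm_clone (lchild i) (perm_clone j g).
Proof.
move=> ij; have ne : g i != g j by rewrite (inj_eq perm_inj) -val_eqE /= ltn_eqF.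
have Lj : rchild j = lift (rchild i) j.
  by apply: val_inj; rewrite /= /bump /=; lia.
have Li : lchild i = lift (rchild j) i.
  by apply: val_inj; rewrite /= /bump /=; lia.
have gj : perm_clone i g (rchild j) = lift (rchild (g i)) (g j).
  by rewrite /perm_clone Lj lift_perm_lift.
have gi : perm_clone j g (lchild i) = lift (rchild (g j)) (g i).
  by rewrite /perm_clone Li lift_perm_lift.
have {}ne : val (g i) != val (g j) by rewrite val_eqE.
apply/permP=> m; rewrite [in LHS]/perm_clone [in RHS]/perm_clone gi gj.
case: (unliftP (rchild (rchild j)) m) => [m1|] em.
  case: (unliftP (rchild i) m1) => [m2|] em1; rewrite em em1 lift_perm_lift.
    have -> : lift (rchild (rchild j)) (lift (rchild i) m2) =
              lift (rchild (lchild i)) (lift (rchild j) m2).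
      by apply: val_inj; rewrite /= /bump /=; lia.
    rewrite !lift_perm_lift; apply: val_inj; rewrite /= /bump /=.
    by move: ne => /=; lia.
  have -> : lift (rchild (rchild j)) (rchild i) = rchild (lchild i).
    by apply: val_inj; rewrite /= /bump /=; lia.
  rewrite !lift_perm_id; apply: val_inj; rewrite /= /bump /=.
  by move: ne => /=; lia.
rewrite em lift_perm_id.
have -> : rchild (rchild j) = lift (rchild (lchild i)) (rchild j).
  by apply: val_inj; rewrite /= /bump /=; lia.
rewrite lift_perm_lift lift_perm_id; apply: val_inj; rewrite /= /bump /=.
by move: ne => /=; lia.
Qed.

Definition perm_cloning : cloning_system :=
  @CloningSystem (fun n => 'S_n) (fun n => id) perm_clone (fun n g h => erefl)
    perm_cloneM (fun n i g => erefl) perm_cloneC.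

Definition cactus_cloning : cloning_system :=
  @CloningSystem cactus cactus_perm cactus_clone cactus_permM
    cactus_cloneM cactus_perm_clone cactus_cloneC.

Definition V : groupType := tree_pair_group perm_cloning.
Definition CV : groupType := tree_pair_group cactus_cloning.

Definition pair_perm (x : tree_pair cactus_cloning) : tree_pair perm_cloning :=
  @TreePair perm_cloning _ (upper x) (cactus_perm (middle x)) (lower x).

(* The map (T_+, s, T_-) |-> (T_+, pi_n(s), T_-): see pi_barE. *)
Definition pi_bar (g : CV) : V :=
  pair_class (pair_perm (generic_quotient.repr g)).

Lemma pi_barE (x : tree_pair cactus_cloning) :
  pi_bar (pair_class x) = pair_class (pair_perm x).
Proof.
have H y z : pair_equiv y z -> pair_equiv (pair_perm y) (pair_perm z).
  elim=> {y z} [y z [i ->]|y|y z _|y z t _ yz _ zt].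
  - apply: rst_step; exists (i : 'I_(psize (pair_perm y))).
    by rewrite /expand /pair_perm /= cactus_perm_clone.
  - exact: rst_refl.
  - exact: rst_sym.
  exact: rst_trans zt.
by apply/pair_classP/H/pair_classP; exact: (reprK (pair_class x)).
Qed.

Lemma pi_barM : {morph pi_bar : g h / g * h}.
Proof.
move=> u v.
have [w [x [y [z [-> -> _ xyz]]]]] := class_mul_ex u v.
rewrite [pair_class x * pair_class y](class_mulE xyz) !pi_barE.
apply/esym/class_mulE; case: xyz => n A B C g h.
rewrite /pair_perm /= cactus_permM.
exact: (@Composes perm_cloning n A B C (cactus_perm g) (cactus_perm h)).
Qed.

HB.instance Definition _ := isMultiplicative.Build CV V pi_bar pi_barM.

Definition PCV : {pred CV} := fun g => pi_bar g == 1.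

(* g has finite order m; the library only has orders in finite groups. *)
Definition has_order (G : groupType) (g : G) (m : nat) : Prop :=
  [/\ 0 < m, g ^+ m = 1 & forall k : nat, 0 < k < m -> g ^+ k <> 1].

(* Main.v *)
Require Import Defs.
From HB Require Import structures.
From mathcomp Require Import all_boot fingroup perm pgroup zify boolp.
From Stdlib Require Import Relation_Operators.

Set Implicit Arguments.
Unset Strict Implicit.
Unset Printing Implicit Defensive.

(** A torsion element g of CV is the class of a pair (T, s, T) whose two trees agree.
    Indeed, g moves the trees that contain its domain tree.  If S contains the domain
    trees of all the powers of g, then the smallest tree T containing all the images of S
    under these powers is mapped by g to a tree that contains all these images again, hence
    contains T, and has as many leaves as T (torsion_carries).  Cloning is injective, so
    that a pair is trivial as soon as its class is (trivial_class): hence s is a torsion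
    element of J_n, and pi_n(s) = 1 if g lies in PCV.  This reduces (1) and (4) to the
    cactus groups: J_n has no odd torsion and ker pi_n is torsion-free.  Then (3) follows
    from (1) and Cauchy's theorem.  For (2), the product of the flips of the first 2, 4,
    ..., 2^k strands has order 2^k (order_pow2_word).

    The study of J_n rests on its relation to right-angled Coxeter groups.  Record for
    each letter s_{i,j} of a word the set of strands that it flips, strands being named by
    their initial positions.  The relations of J_n become the relations A A = 1 and
    A B = B A, for A and B disjoint or nested, of a right-angled Coxeter group; so the
    reduced form of the word of sets, up to commutations, depends only on the element of
    J_n (walls_equiv).  Conversely a set that can be moved to the front of the word is an
    interval of initial positions, and the corresponding letter can be moved to the front
    within J_n (walls_lead).  Geometrically, the Cayley graph of J_n is a convex subgraph of
    that of the Coxeter group, on which J_n acts freely on vertices.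

    No odd torsion (no_odd_torsion).  Let g have odd order m, and choose the vertex x
    minimising the sum of the distances to the m points g^k.  By minimality, and since m is
    odd, each wall next to x has a strict majority of the points on the side of x; the
    same holds at g x.  If g x <> x, some wall next to x on the way to g x and some wall next
    to g x on this way are equal or do not cross, and the two majorities contradict each
    other (descent_transfer).  Hence g x = x and g = 1.

    No torsion in ker pi_n (no_pure_torsion).  By the odd case, it is enough to exclude
    involutions.  In a pure involution of minimal length in its conjugacy class, each first
    letter commutes with all the others, as otherwise it could be conjugated away.  So
    all the sets in its word are pairwise disjoint or nested, and then some two strands lie
    together in exactly one of them.  Since each letter exchanges the order of the pairs of
    strands that it contains, these two strands are exchanged: the element is not pure. *)

Local Open Scope group_scope.

(** * Words in a right-angled Coxeter group *)

Section Words.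

Variables (T : eqType) (com : rel T).
Hypotheses (comC : symmetric com) (com_irr : irreflexive com).
Implicit Types (a b : T) (u v w : seq T).

(** The letter a occurs in w and can be brought to the front by commutations. *)
Fixpoint lead a w :=
  if w is b :: w' then (a == b) || com a b && lead a w' else false.

(** Left multiplication by the involution a, on reduced words. *)
Definition push a w := if lead a w then rem a w else a :: w.

Definition reduce w := foldr push [::] w.

Fixpoint reduced w := if w is a :: w' then ~~ lead a w' && reduced w' else true.

(** Equality up to commutations.  Two words differ by commutations exactly when, for all
    letters a and b that do not commute (including a = b), their subwords on a and b are
    equal. *)
Definition shuffle v w := forall a b, ~~ com a b ->
  [seq c <- v | pred2 a b c] = [seq c <- w | pred2 a b c].

Lemma shuffle_sym v w : shuffle v w -> shuffle w v.
Proof. by move=> vw a b nab; rewrite vw. Qed.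

Lemma shuffle_trans u v w : shuffle u v -> shuffle v w -> shuffle u w.
Proof. by move=> uv vw a b nab; rewrite uv // vw. Qed.

Lemma shuffle_perm v w : shuffle v w -> perm_eq v w.
Proof.
move=> vw; apply/allP => a _ /=; rewrite -!size_filter.
by have := vw a a; rewrite com_irr => /(_ isT); rewrite /= (eq_filter (a2 := pred1 a))
  ?[in RHS](eq_filter (a2 := pred1 a)) => [->||]// c; rewrite /= orbb.
Qed.

Lemma leadP a w :
  lead a w <-> forall b, ~~ com a b -> ohead [seq c <- w | pred2 a b c] = Some a.
Proof.
elim: w => [|c w IH]; first by split=> // /(_ a); rewrite com_irr => /(_ isT).
rewrite /= eq_sym; have [->|nca] /= := eqVneq c a; first by split=> // _ b _.
case: (boolP (com a c)) => /= [ac|nac]; last first.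
  by split=> // /(_ _ nac); rewrite eqxx /= => -[/eqP]; rewrite (negPf nca).
split=> [/IH lw b nab|lw]; first by rewrite ifN ?lw //; apply: contraNneq nab => <-.
apply/IH => b nab; have := lw b nab; rewrite ifN //.
by apply: contraNneq nab => <-.
Qed.

Lemma lead_shuffle a v w : shuffle v w -> lead a v = lead a w.
Proof.
by move=> vw; apply/idP/idP => /leadP H; apply/leadP => b nab; have := vw a b nab;
  [move=> <-|move=> ->]; exact: H.
Qed.

Lemma lead_mem a w : lead a w -> a \in w.
Proof.
by elim: w => //= b w IH /orP[/eqP->|/andP[_ /IH aw]]; rewrite inE ?eqxx ?aw ?orbT.
Qed.

Lemma filter_rem (p : pred T) a w : filter p (rem a w) = rem a (filter p w).
Proof.
elim: w => //= b w IH; have [->|nba] := eqVneq b a.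
  case: ifP => [pa|/negbT npa] /=; first by rewrite eqxx.
  by rewrite rem_id // mem_filter (negPf npa).
by rewrite /= IH; case: ifP => //= _; rewrite (negPf nba).
Qed.

Lemma push_shuffle a v w : shuffle v w -> shuffle (push a v) (push a w).
Proof.
move=> vw; rewrite /push (lead_shuffle a vw); case: ifP => _ b c nbc.
  by rewrite !filter_rem vw.
by rewrite /= (vw _ _ nbc).
Qed.

Lemma foldr_push_shuffle u v w :
  shuffle v w -> shuffle (foldr push v u) (foldr push w u).
Proof. by elim: u => //= a u IH /IH; exact: push_shuffle. Qed.

Lemma lead_com a b w : lead a w -> lead b w -> a != b -> com a b.
Proof.
elim: w => //= c w IH /orP[/eqP->|/andP[ac la]] /orP[/eqP->|/andP[bc lb]] //.
- by rewrite eqxx.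
- by rewrite comC.
exact: IH.
Qed.

Lemma lead_rem a b w : com a b -> lead a (rem b w) = lead a w.
Proof.
move=> ab; have nab : a != b by apply: contraTneq ab => ->; rewrite com_irr.
elim: w => //= c w IH; have [->|ncb] := eqVneq c b; first by rewrite (negPf nab) ab.
by rewrite /= IH.
Qed.

Lemma lead_push a b w : com a b -> lead a (push b w) = lead a w.
Proof.
move=> ab; rewrite /push; case: ifP => _; first exact: lead_rem.
by rewrite /= ab; have [e|] := eqVneq a b => //; rewrite e com_irr in ab.
Qed.

Lemma rem_rem a b w : rem a (rem b w) = rem b (rem a w).
Proof.
elim: w => //= c w IH; have [eb|nb] := eqVneq c b; have [ea|na] := eqVneq c a => /=.
- by rewrite -eb -ea.
- by rewrite eb eqxx.
- by rewrite ea eqxx.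
by rewrite (negPf nb) (negPf na) IH.
Qed.

Lemma pushC a b w : com a b -> shuffle (push a (push b w)) (push b (push a w)).
Proof.
move=> ab; have ba : com b a by rewrite comC.
have nab : a != b by apply: contraTneq ab => ->; rewrite com_irr.
rewrite {1}/push lead_push // [X in shuffle _ X]/push lead_push //.
rewrite /push; case: ifP => la; case: ifP => lb //=.
- by rewrite rem_rem.
- by rewrite eq_sym (negPf nab).
- by rewrite (negPf nab).
move=> c d ncd /=; have [ea|na] := boolP (_ || _); have [eb|nb] := boolP (_ || _) => //.
by move: ea eb ncd nab => /orP[]/eqP<- /orP[]/eqP<-; rewrite ?ab ?ba // eqxx.
Qed.

Lemma shuffle_lead a w : lead a w -> shuffle (a :: rem a w) w.
Proof.
move=> /leadP la b c nbc; rewrite /= filter_rem.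
have [|] := boolP (_ || _) => [|nabc].
  move=> abc; have nac : ohead [seq x <- w | pred2 b c x] = Some a.
    case/orP: abc nbc => /eqP<- n; first exact: la.
    rewrite (eq_filter (a2 := pred2 a b)); last by move=> x /=; rewrite orbC.
    by apply: la; rewrite comC.
  by case: [seq _ <- w | _] nac => //= d s [->]; rewrite eqxx.
by rewrite rem_id // mem_filter (negPf nabc).
Qed.

Lemma push_reduced a w : reduced w -> reduced (push a w).
Proof.
rewrite /push; case: ifP => /= [la|-> //]; elim: w la => //= b w IH.
have [<-|nab] /= := eqVneq a b; first by move=> _ /andP[].
by move=> /andP[ab la] /andP[nlb rw]; rewrite /= IH // andbT lead_rem 1?comC.
Qed.

Lemma reduced_reduce w : reduced (reduce w).
Proof. by elim: w => //= a w IH; exact: push_reduced. Qed.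

Lemma lead_rem_self a w : reduced w -> lead a w -> ~~ lead a (rem a w).
Proof.
elim: w => //= b w IH; have [<-|nab] /= := eqVneq a b; first by move=> /andP[].
by move=> /andP[_ rw] /andP[ab la]; rewrite (negPf nab) ab /= IH.
Qed.

Lemma lead_push_self a w : reduced w -> lead a (push a w) = ~~ lead a w.
Proof.
move=> rw; rewrite /push; case: ifPn => la /=; last by rewrite eqxx.
exact/negbTE/lead_rem_self.
Qed.

(** Together with pushC, this says that push is an action of the right-angled Coxeter group
    on the reduced words up to commutations; hence reduce is an invariant of group elements. *)
Lemma pushK a w : reduced w -> shuffle (push a (push a w)) w.
Proof.
move=> rw; rewrite {1}/push lead_push_self //; case: ifPn => la; last first.
  by rewrite negbK in la; rewrite /push la; exact: shuffle_lead.
by rewrite /push (negPf la) /= eqxx.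
Qed.

Lemma reduce_id w : reduced w -> reduce w = w.
Proof. by elim: w => //= a w IH /andP[la /IH->]; rewrite /push (negPf la). Qed.

Lemma size_push a w : size (push a w) <= (size w).+1.
Proof.
by rewrite /push; case: ifP => // /lead_mem am; rewrite size_rem //; lia.
Qed.

Lemma size_reduce w : size (reduce w) <= size w.
Proof. by elim: w => //= a w IH; have := size_push a (reduce w); lia. Qed.

Lemma reduced_size w : size (reduce w) = size w -> reduced w.
Proof.
elim: w => //= a w IH; rewrite /push; case: ifP => [la|nla] /= => [|[e]].
  by rewrite size_rem ?lead_mem //; have := size_reduce w; lia.
by rewrite -[in lead _ _](reduce_id (IH e)) nla IH.
Qed.

(** If c is blocked by a leading letter, it cannot cancel. *)
Lemma lead_push_lead a c w : lead a w -> ~~ com c a -> c != a -> lead c (push c w).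
Proof.
move=> la nca ne; rewrite /push ifN /= ?eqxx //.
by apply: contra nca => lc; exact: lead_com lc la ne.
Qed.

Lemma lead_rcons a w : lead a (rcons w a) -> lead a w \/ all (com a) w.
Proof.
elim: w => /= [|b w IH]; first by right.
case/orP => [->|/andP[ab /IH[]->]]; rewrite ?ab ?orbT; by [left|right].
Qed.

Lemma lead_pairwise v a w : {in v, forall b, {in a :: w, forall c, com b c}} ->
  lead a (v ++ a :: w).
Proof.
elim: v => /= [|b v IH H]; first by rewrite eqxx.
rewrite IH; last by move=> x xv; apply: H; rewrite inE xv orbT.
by rewrite comC H ?mem_head ?orbT.
Qed.

(** A letter that commutes with all the others only contributes a parity to the reduced
    form. *)
Lemma filter_reduce_central c w : all (fun a => (a == c) || com a c) w ->
  [seq a <- reduce w | a != c] = reduce [seq a <- w | a != c].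
Proof.
have leadE a v : com a c -> lead a [seq b <- v | b != c] = lead a v.
  move=> ac; have nac : a != c by apply: contraTneq ac => ->; rewrite com_irr.
  by elim: v => //= b v IH; have [->|_] := eqVneq b c; rewrite /= IH // (negPf nac) ac.
elim: w => //= a w IH /andP[ac /IH {}IH].
case: eqVneq ac => [->|nac] /= => [_|ac].
  rewrite -IH /push; case: ifP => _ /=; last by rewrite eqxx.
  by rewrite filter_rem rem_id // mem_filter eqxx.
rewrite -IH /push leadE //; case: ifP => _; last by rewrite /= nac.
by rewrite filter_rem.
Qed.

End Words.

Section MapWords.

Variables (T T' : eqType) (com : rel T) (com' : rel T') (f : T -> T').
Hypotheses (f_inj : injective f) (f_com : {mono f : a b / com a b >-> com' a b}).

Lemma lead_map a w : lead com' (f a) (map f w) = lead com a w.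
Proof. by elim: w => //= b w ->; rewrite (inj_eq f_inj) f_com. Qed.

Lemma map_rem a w : map f (rem a w) = rem (f a) (map f w).
Proof. by elim: w => //= b w IH; rewrite (inj_eq f_inj) (fun_if (map f)) /= IH. Qed.

Lemma map_push a w : map f (push com a w) = push com' (f a) (map f w).
Proof. by rewrite /push lead_map (fun_if (map f)) /= map_rem. Qed.

Lemma map_reduce w : map f (reduce com w) = reduce com' (map f w).
Proof. by elim: w => //= a w <-; exact: map_push. Qed.

Lemma reduced_map w : reduced com' (map f w) = reduced com w.
Proof. by elim: w => //= a w ->; rewrite lead_map. Qed.

End MapWords.

(** * Laminar pairs of sets *)

Section Laminar.
Variable n : nat.
Implicit Types A B : {set 'I_n}.

(** Families of sets whose members are pairwise laminar are cliques of the Coxeter graph.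
    The relation is irreflexive because two equal letters cancel rather than commute. *)
Definition laminar A B := (A != B) && [|| [disjoint A & B], A \subset B | B \subset A].

Lemma laminarC : symmetric laminar.
Proof.
by move=> A B; rewrite /laminar eq_sym disjoint_sym [(A \subset B) || _]orbC.
Qed.

Lemma laminar_irr : irreflexive laminar.
Proof. by move=> A; rewrite /laminar eqxx. Qed.

End Laminar.

Section Preim.
Variables (m n : nat) (f : 'I_m -> 'I_n) (f' : 'I_n -> 'I_m).
Hypothesis fK : cancel f' f.

Lemma subset_preim (A B : {set 'I_n}) : (f @^-1: A \subset f @^-1: B) = (A \subset B).
Proof.
apply/idP/idP => /subsetP AB; apply/subsetP => x; last by rewrite !inE; exact: AB.
by have := AB (f' x); rewrite !inE fK.
Qed.

Lemma preim_inj : injective (fun A : {set 'I_n} => f @^-1: A).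
Proof. by move=> A B /eqP; rewrite eqEsubset !subset_preim -eqEsubset => /eqP. Qed.

Lemma laminar_preim :
  {mono (fun A : {set 'I_n} => f @^-1: A) : A B / laminar A B >-> laminar A B}.
Proof.
move=> A B; rewrite /laminar !disjoints_subset -preimsetC !subset_preim.
by rewrite (inj_eq preim_inj).
Qed.

End Preim.

(** * Words of walls in the cactus groups *)

Section Walls.
Variable n : nat.
Implicit Types (s t : gen n) (v w : seq (gen n)) (A B : {set 'I_n}) (g h : cactus n).

Definition supp s : {set 'I_n} := [set m : 'I_n | glo s <= m <= ghi s].

(** The sets of strands flipped by the letters of w, each strand being named by its position
    before w.  The flip s renames the strands for the letters that follow s. *)
Fixpoint walls w : seq {set 'I_n} :=
  if w is s :: w' then supp s :: [seq flip s @^-1: A | A : {set 'I_n} <- walls w'] else [::].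

Lemma walls_cat v w :
  walls (v ++ w) = walls v ++ [seq word_perm v @^-1: A | A : {set 'I_n} <- walls w].
Proof.
elim: v => [|s v IH] /=.
  by rewrite (eq_map (g := id)) ?map_id // => A; apply/setP => m; rewrite inE perm1.
rewrite IH map_cat -map_comp; congr (_ :: _ ++ _); apply: eq_map => A.
by apply/setP => m; rewrite !inE permM.
Qed.

Lemma size_walls w : size (walls w) = size w.
Proof. by elim: w => //= s w <-; rewrite size_map. Qed.

Lemma flip_preim_out s A : [disjoint A & supp s] -> flip s @^-1: A = A.
Proof.
move=> /pred0P dA; apply/setP => m; rewrite inE.
case: (boolP (m \in supp s)) => ms.
  have ms' : flip s m \in supp s by move: ms; rewrite !inE flipE; case: ifP; lia.
  by have := dA (flip s m); have := dA m; rewrite /= ms ms' !andbT => -> ->.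
by congr (_ \in A); apply: val_inj; rewrite /= flipE ifN //; move: ms; rewrite inE.
Qed.

Lemma flip_preim_sub s A : supp s \subset A -> flip s @^-1: A = A.
Proof.
move=> sA; apply: setC_inj; rewrite -preimsetC; apply: flip_preim_out.
by rewrite disjoint_sym disjoints_subset setCK.
Qed.

Lemma flip_preim_in s t u : glo s <= glo t -> ghi t <= ghi s ->
  glo u = (glo s + ghi s - ghi t)%N :> nat -> ghi u = (glo s + ghi s - glo t)%N :> nat ->
  flip s @^-1: supp t = supp u.
Proof.
move=> st ts eg eh; have := glo_lt_ghi t => Lt.
by apply/setP => m; rewrite !inE flipE eg eh; case: ifP; lia.
Qed.

Lemma flip_preimK s A : flip s @^-1: (flip s @^-1: A) = A.
Proof.
apply/setP=> m; rewrite !inE; congr (_ \in A); apply: val_inj => /=.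
by rewrite !flipE; do !case: ifP; lia.
Qed.

Lemma disjoint_supp s t : [disjoint supp s & supp t] = (ghi s < glo t) || (ghi t < glo s).
Proof.
have Ls := glo_lt_ghi s; have Lt := glo_lt_ghi t; apply/idP/idP => [/pred0P d|d].
  by have := d (glo s); have := d (glo t); rewrite /= !inE; lia.
by apply/pred0P => m /=; rewrite !inE; lia.
Qed.

Lemma sub_supp s t : (supp s \subset supp t) = (glo t <= glo s) && (ghi s <= ghi t).
Proof.
have Ls := glo_lt_ghi s; apply/idP/idP => [/subsetP d|d].
  by have := d (glo s); have := d (ghi s); rewrite !inE; lia.
by apply/subsetP => m; rewrite !inE; lia.
Qed.

Lemma supp_inj s t : supp s = supp t -> s = t.
Proof.
move=> e; have := subxx (supp s); rewrite {2}e; have := subxx (supp t); rewrite -{2}e.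
rewrite !sub_supp => H1 H2.
have e1 : glo s = glo t by apply: val_inj => /=; lia.
have e2 : ghi s = ghi t by apply: val_inj => /=; lia.
apply: val_inj; rewrite (surjective_pairing (val s)).
by rewrite [X in (X, _)]e1 [X in (_, X)]e2 -surjective_pairing.
Qed.

Lemma gen_ex a b : a < b -> b < n -> exists u : gen n, glo u = a :> nat /\ ghi u = b :> nat.
Proof.
move=> ab bn; have an := ltn_trans ab bn.
by exists (@mkgen n (Ordinal an) (Ordinal bn) ab).
Qed.

Let LC := @laminarC n.
Let LI := @laminar_irr n.
Notation push := (push (@laminar n)).
Notation lead := (lead (@laminar n)).
Notation reduce := (reduce (@laminar n)).
Notation reduced := (reduced (@laminar n)).
Notation shuffle := (shuffle (@laminar n)).

Lemma laminar_preim_perm (p : 'S_n) :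
  {mono (fun A : {set 'I_n} => p @^-1: A) : A B / laminar A B >-> laminar A B}.
Proof. by apply: laminar_preim => x; exact: permKV. Qed.

Lemma preim_perm_inj (p : 'S_n) : injective (fun A : {set 'I_n} => p @^-1: A).
Proof. by apply: preim_inj => x; exact: permKV. Qed.

Lemma lead_preim (p : 'S_n) A W :
  lead (p @^-1: A) [seq p @^-1: B | B : {set 'I_n} <- W] = lead A W.
Proof. exact: (lead_map (@preim_perm_inj p) (@laminar_preim_perm p)). Qed.

(** Two laminar sets flipped in succession can be flipped in the other order, since each of
    them is an interval before and after the other flip. *)
Lemma swap_laminar s t : laminar (supp s) (supp t) ->
  exists s' t', [/\ cactus_class [:: t; s] = cactus_class [:: s'; t']
    & supp s' = flip t @^-1: supp s].
Proof.
move=> /andP[_]; have Ls := glo_lt_ghi s; have Lt := glo_lt_ghi t.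
case/or3P => [ds|st|ts].
- exists s, t; rewrite flip_preim_out //; split=> //; move: ds; rewrite disjoint_supp.
  by case/orP => st; [apply/esym|]; apply: cactus_class_rel; constructor.
- move: st; rewrite sub_supp => /andP[st1 st2].
  have Lt' := ltn_ord (ghi t).
  have [||u [u1 u2]] := @gen_ex (glo t + ghi t - ghi s) (glo t + ghi t - glo s); [lia|lia|].
  exists u, t; split; last by rewrite (flip_preim_in st1 st2 u1 u2).
  by apply: cactus_class_rel; constructor.
rewrite flip_preim_sub //; move: ts; rewrite sub_supp => /andP[ts1 ts2].
have Ls' := ltn_ord (ghi s).
have [||u [u1 u2]] := @gen_ex (glo s + ghi s - ghi t) (glo s + ghi s - glo t); [lia|lia|].
exists s, u; split=> //; apply/esym/cactus_class_rel.
by constructor; lia.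
Qed.

(** Commutations of the word of sets lift to J_n, by swap_laminar.  This is the convexity of
    the Cayley graph of J_n. *)
Lemma walls_lead w A : lead A (walls w) ->
  exists s v, [/\ A = supp s, cactus_class w = cactus_class (s :: v) & size w = (size v).+1].
Proof.
elim: w A => //= t w IH A /orP[/eqP->|/andP[At]]; first by exists t, w.
have {1}-> : A = flip t @^-1: (flip t @^-1: A) by rewrite flip_preimK.
rewrite lead_preim; case/IH => s [v [es ew ->]].
have : laminar (supp s) (supp t).
  by rewrite -es -[supp t](flip_preim_sub (subxx (supp t))) laminar_preim_perm.
case/swap_laminar => s' [t' [e1 e2]]; exists s', (t' :: v); split=> //.
  by rewrite e2 -es flip_preimK.
rewrite -[t :: w]/([:: t] ++ w) cactus_classM ew -cactus_classM.
by rewrite -[_ ++ _]/([:: t; s] ++ v) cactus_classM e1 -cactus_classM.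
Qed.

Lemma walls_rel x y (p : 'S_n) u : cactus_rel x y -> reduced u ->
  shuffle (foldr push u [seq p @^-1: A | A : {set 'I_n} <- walls x])
          (foldr push u [seq p @^-1: A | A : {set 'I_n} <- walls y]).
Proof.
move=> xy ru.
case: xy => [s|s t st|s t v st ts eu1 eu2] /=.
- by rewrite flip_preim_sub //; exact: pushK.
- have Ls := glo_lt_ghi s; have Lt := glo_lt_ghi t.
  have d : [disjoint supp s & supp t] by rewrite disjoint_supp st.
  rewrite !flip_preim_out // 1?disjoint_sym //; apply: pushC => //.
  rewrite laminar_preim_perm /laminar d andbT; apply: contraTneq d => ->.
  by rewrite disjoint_supp; lia.
have Ls := glo_lt_ghi s; have Lt := glo_lt_ghi t.
rewrite (flip_preim_in st ts eu1 eu2).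
have vs : supp v \subset supp s by rewrite sub_supp; lia.
rewrite (flip_preim_sub vs); have [->//|ne] := eqVneq (supp s) (supp v).
by apply: pushC => //; rewrite laminar_preim_perm /laminar ne vs !orbT.
Qed.

Lemma walls_equiv v w : cactus_equiv v w -> shuffle (reduce (walls v)) (reduce (walls w)).
Proof.
elim=> {v w} [v w [a [b [x [y [-> -> xy]]]]]|v|v w _|v w z _ vw _ wz] //.
- rewrite /reduce !walls_cat !map_cat !foldr_cat (word_perm_rel xy).
  apply: foldr_push_shuffle => //; apply: walls_rel => //.
  exact: reduced_reduce.
- exact: shuffle_sym.
exact: shuffle_trans wz.
Qed.

(** * Length and descents *)

(** The element of the Coxeter group attached to g, as a reduced word up to commutations. *)
Definition trace g := reduce (walls (cactus_word g)).
Definition len g := size (trace g).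
(** The wall between 1 and s also separates 1 from g. *)
Definition desc s g := lead (supp s) (trace g).
Definition sgen s : cactus n := cactus_class [:: s].

Lemma trace_class w : shuffle (trace (cactus_class w)) (reduce (walls w)).
Proof. by apply: walls_equiv; apply/cactus_classP; exact: cactus_wordK. Qed.

Lemma sgen_cons s w : cactus_class (s :: w) = sgen s * cactus_class w.
Proof. by rewrite -cactus_classM. Qed.

Lemma sgenK s : sgen s * sgen s = 1.
Proof. by rewrite -cactus_classM; apply: cactus_class_rel; constructor. Qed.

Lemma sgenV s : (sgen s)^-1 = sgen s.
Proof. by apply: (mulgI (sgen s)); rewrite mulgV sgenK. Qed.

Lemma trace_sgen s g : shuffle (trace (sgen s * g))
  (push (supp s) [seq flip s @^-1: A | A : {set 'I_n} <- trace g]).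
Proof.
rewrite -{1}[g]cactus_wordK -sgen_cons; apply: shuffle_trans (trace_class _) _ => /=.
by rewrite /trace (map_reduce (@preim_perm_inj (flip s)) (@laminar_preim_perm (flip s))).
Qed.

Lemma desc_sgen s g : desc s (sgen s * g) = ~~ desc s g.
Proof.
rewrite /desc (lead_shuffle LI _ (trace_sgen s g)) lead_push_self //.
  by rewrite -[X in lead X _](flip_preim_sub (subxx (supp s))) lead_preim.
rewrite (reduced_map (@preim_perm_inj (flip s)) (@laminar_preim_perm (flip s))).
exact: reduced_reduce.
Qed.

Lemma len_sgen s g : (len (sgen s * g)%g + (desc s g).*2 = (len g).+1)%N.
Proof.
rewrite {1}/len (perm_size (shuffle_perm LI (trace_sgen s g))) /push.
rewrite -{1}(flip_preim_sub (subxx (supp s))) lead_preim -/(desc s g).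
case: (boolP (desc s g)) => /= [d|_]; last by rewrite size_map addn0.
have d' : lead (supp s) [seq flip s @^-1: A | A : {set 'I_n} <- trace g].
  by rewrite -(flip_preim_sub (subxx (supp s))) lead_preim.
have := lead_mem d'; move=> m; rewrite size_rem // size_map -/(len g).
have := lead_mem d; rewrite /len; case: (trace g) => //= ? ? _; lia.
Qed.

Lemma len_class w : len (cactus_class w) <= size w.
Proof.
by rewrite /len (perm_size (shuffle_perm LI (trace_class w))) -size_walls size_reduce.
Qed.

Lemma geodesic_reduced w : size w = len (cactus_class w) -> reduced (walls w).
Proof.
move=> e; apply: reduced_size; rewrite size_walls e.
by rewrite /len (perm_size (shuffle_perm LI (trace_class w))).
Qed.

(** If prepending s to a geodesic v shortens it, then the set of s leads walls v, so v can be
    rewritten to start with s, and the two copies of s cancel. *)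
Lemma geodesic_ex g : exists2 w, cactus_class w = g & size w = len g.
Proof.
suff H w : exists2 v, cactus_class v = cactus_class w & size v = len (cactus_class v).
  by have [v ev sv] := H (cactus_word g); rewrite cactus_wordK in ev; exists v; rewrite // -ev.
have [k] := ubnP (size w); elim: k w => // k IH w ltk.
case: w ltk => [|s w] ltk; first by exists [::] => //; have := len_class [::]; case: len.
have [v ev sv] := IH w ltk.
have := len_sgen s (cactus_class v); rewrite ev -sgen_cons.
case: (boolP (desc s _)) => /= d; last first.
  by exists (s :: v); rewrite sgen_cons ev -sgen_cons //= sv ev; lia.
rewrite -ev /desc (lead_shuffle LI _ (trace_class v)) reduce_id in d;
  last exact: geodesic_reduced.
have [s' [v' [/supp_inj <- ev' sv']]] := walls_lead d.
have [|u eu su] := IH v'.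
  have := len_class w; move: ltk sv sv'; rewrite /= ev; lia.
move=> _; exists u => //.
by rewrite eu sgen_cons -ev ev' sgen_cons mulgA sgenK mul1g.
Qed.

Lemma trace_geodesic w : size w = len (cactus_class w) ->
  shuffle (trace (cactus_class w)) (walls w).
Proof.
by move=> /geodesic_reduced rw; have := trace_class w; rewrite (reduce_id rw).
Qed.

(** * Cactus groups have no odd torsion *)

(** In a geodesic from 1 to h there is a chain of walls, consecutive ones not crossing, from
    a wall a at the start to a wall b at the end.  If b does not cancel against y, then no wall
    of the chain does, and a remains at the front of the reduced form of h y.  The chain is
    built from the end: the new letter c either commutes with the front of the chain, which
    then stays at the front, or is prepended to the chain. *)
Lemma descent_transfer h : h != 1 -> exists a b, forall y, ~~ desc b y -> desc a (h * y).
Proof.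
have [w <- /geodesic_reduced rw] := geodesic_ex h => h1.
suff [a [b [_ H]]] : exists a b, lead (supp a) (walls w) /\
  forall y, ~~ desc b y -> desc a (cactus_class w * y) by exists a, b.
have : w != [::] by apply: contraNneq h1 => ->.
elim: w rw {h1} => // c [|d w] IH /andP[nl rw] _.
  by exists c, c; rewrite /= eqxx; split=> // y; rewrite -/(sgen c) desc_sgen.
have {}rw : reduced (walls (d :: w)).
  by rewrite -(reduced_map (@preim_perm_inj (flip c)) (@laminar_preim_perm (flip c))).
have [a [b [la H]]] := IH rw isT; move: nl; rewrite -/(walls (d :: w)).
move: (d :: w) rw la H => {d IH}w rw la H nl.
rewrite -(lead_preim (flip c)) in la.
have ne : supp c != flip c @^-1: supp a by apply: contraNneq nl => ->.
have [lam|nlam] := boolP (laminar (supp c) (flip c @^-1: supp a)); last first.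
  exists c, b; split=> [|y /H]; first by rewrite /= eqxx.
  rewrite sgen_cons -mulgA /desc (lead_shuffle LI _ (trace_sgen _ _)).
  rewrite -(lead_preim (flip c)) => dy.
  exact: (lead_push_lead LC dy nlam ne).
have la' : lead (flip c @^-1: supp a) (walls (c :: w)).
  by rewrite /= laminarC lam la orbT.
have [s [_ [es _ _]]] := walls_lead la'.
exists s, b; rewrite -es; split=> // y /H.
rewrite sgen_cons -mulgA /desc (lead_shuffle LI _ (trace_sgen _ _)) -es.
by rewrite -(lead_preim (flip c)) lead_push // laminarC.
Qed.

Lemma sum_len_sgen (Y : nat -> cactus n) m s :
  (\sum_(k < m) len (sgen s * Y k)%g + (\sum_(k < m) desc s (Y k)).*2 =
   \sum_(k < m) len (Y k) + m)%N.
Proof.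
rewrite -mul2n big_distrr /= -big_split /= -[X in (_ + X)%N](card_ord m) -sum1_card -big_split.
by apply: eq_bigr => k _; rewrite mul2n len_sgen -addn1.
Qed.

(** The points x g^k are seen from the vertex 1, that is, everything is translated by the
    inverse of the minimising vertex; the translated group element is x g x^-1. *)
Lemma no_odd_torsion m g : odd m -> g ^+ m = 1 -> g = 1.
Proof.
move=> om gm; pose Y (x : cactus n) k : cactus n := x * g ^+ k.
pose f x := \sum_(k < m) len (Y x k).
have [x fx] : exists x, forall y, f x <= f y.
  have [k] := ubnP (f 1); elim: k 1 => // k IH x ltk.
  have [[y yx]|no] := pselect (exists y, f y < f x); first by apply: (IH y); lia.
  by exists x => y; rewrite leqNgt; apply/negP => yx; apply: no; exists y.
(* At most half of the points have a descent at s, as moving the vertex across s does not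
   decrease f; exactly half is impossible for odd m. *)
have half s : (\sum_(k < m) desc s (Y x k)).*2 < m.
  have := fx (sgen s * x); have := sum_len_sgen (Y x) m s.
  have -> : f (sgen s * x) = (\sum_(k < m) len (sgen s * Y x k)%g)%N.
    by apply: eq_bigr => k _; rewrite /Y mulgA.
  by rewrite -/(f x); move: om; move: (\sum_(k < m) desc s (Y x k)) => N; lia.
have [->//|g1] := eqVneq g 1; have h1 : x * g * x^-1 != 1.
  by rewrite -[1](mulgV x) (inj_eq (mulIg _)) -[X in _ != X]mulg1 (inj_eq (mulgI _)).
have [a [b H]] := descent_transfer h1.
(* The points are permuted cyclically by x g x^-1. *)
have shift : \sum_(k < m) desc a (Y x k) = \sum_(k < m) desc a (Y x k.+1).
  case: m {f fx half} om gm => // m _ gm.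
  rewrite big_ord_recl big_ord_recr /= addnC /Y gm expg0; congr (_ + _)%N.
have : (m <= \sum_(k < m) desc b (Y x k) + \sum_(k < m) desc a (Y x k.+1))%N.
  rewrite -big_split -[X in X <= _](card_ord m) -sum1_card; apply: leq_sum => k _ /=.
  case: (boolP (desc b _)) => // /H.
  by rewrite /Y [x * g * _ * _]mulgA mulgVK -mulgA -expgS => ->; rewrite addnC.
by have := half a; have := half b; rewrite -shift; lia.
Qed.

(** * Pure cactus groups are torsion-free *)

Lemma cactus_perm1 : cactus_perm (1 : cactus n) = 1.
Proof. by rewrite -[1]/(cactus_class [::]) cactus_permE. Qed.

Lemma cactus_permX g k : cactus_perm (g ^+ k) = cactus_perm g ^+ k.
Proof. by elim: k => [|k IH]; rewrite ?expg0 ?cactus_perm1 // !expgS cactus_permM IH. Qed.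

Lemma cactus_class_rev w : cactus_class (rev w) = (cactus_class w)^-1.
Proof. by rewrite -cactus_invE. Qed.

Lemma word_perm_rev w : word_perm (rev w) = (word_perm w)^-1.
Proof.
rewrite -!cactus_permE cactus_class_rev; apply: (mulgI (cactus_perm (cactus_class w))).
by rewrite -cactus_permM !mulgV cactus_perm1.
Qed.

Lemma walls_rev w : walls (rev w) =
  [seq (word_perm w)^-1 @^-1: A | A : {set 'I_n} <- rev (walls w)].
Proof.
elim: w => //= s w IH; rewrite !rev_cons -[X in walls X]cats1 walls_cat IH.
rewrite map_rcons -cats1 -map_rev -map_comp.
congr (_ ++ _).
  apply: eq_map => A; apply/setP => m; rewrite !inE; congr (_ \in A).
  by rewrite invMg permM permKV.
rewrite /= word_perm_rev; congr [:: _]; apply/setP => m.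
rewrite -[in RHS](flip_preim_sub (subxx (supp s))) inE invMg [in RHS]inE permM.
by rewrite [in RHS]inE permKV.
Qed.

(** Each flip reverses the order of exactly the pairs of strands that it contains. *)
Lemma parity_walls w (a b : 'I_n) : a != b ->
  (word_perm w a < word_perm w b) =
  (a < b) (+) odd (count (fun A : {set 'I_n} => (a \in A) && (b \in A)) (walls w)).
Proof.
elim: w a b => [|s w IH] a b nab /=; first by rewrite !perm1 addbF.
rewrite !permM IH ?(inj_eq perm_inj) // count_map oddD addbA; congr (_ (+) odd _).
  have : a != b :> nat by []. rewrite !inE.
  by rewrite !flipE; do !case: ifP; lia.
by apply: eq_count => A; rewrite /= !inE.
Qed.

Lemma walls_card w A : A \in walls w -> 1 < #|A|.
Proof.
elim: w A => //= s w IH A; rewrite inE => /orP[/eqP->|/mapP[B /IH cB ->]].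
  have L := glo_lt_ghi s; apply/card_gt1P; exists (glo s), (ghi s).
  by rewrite !inE; split; [lia|lia|rewrite -val_eqE /=; lia].
by rewrite card_preimset //; exact: perm_inj.
Qed.

(** Take A maximal in the laminar family W, a point a of A, the largest proper subset B of A
    in W containing a (if any), and b in A but not in B.  Every member of W containing a
    other than A lies in B, hence avoids b. *)
Lemma clique_odd_pair (W : seq {set 'I_n}) : uniq W -> W != [::] ->
  {in W, forall A, 1 < #|A|} -> {in W &, forall A B, A != B -> laminar A B} ->
  exists a b, a != b /\ count (fun A : {set 'I_n} => (a \in A) && (b \in A)) W = 1%N.
Proof.
move=> uW; case: W uW => // A0 W' uW _; move: (A0 :: W') (mem_head A0 W') uW => W A0W uW cW lW.
have [A AW maxA] := arg_maxnP (fun A : {set 'I_n} => #|A|) A0W.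
have {}AW : A \in W := AW.
have /card_gt0P[a aA] : 0 < #|A| by rewrite (ltn_trans _ (cW A AW)).
suff [b [bA nab H]] : exists b, [/\ b \in A, a != b &
    forall C, C \in W -> C != A -> a \in C -> b \notin C].
  exists a, b; split=> //; rewrite (eq_in_count (a2 := pred1 A)) ?count_uniq_mem // ?AW //.
  move=> C CW /=; have [->|nCA] := eqVneq; first by rewrite aA bA.
  by apply/negP => /andP[aC]; apply/negP; exact: H.
have meet C D : C \in W -> D \in W -> C != D -> a \in C -> a \in D ->
    C \subset D \/ D \subset C.
  move=> CW DW ne aC aD.
  have /andP[_ /or3P[/pred0P/(_ a)|->|->]] := lW _ _ CW DW ne; [|by left|by right].
  by rewrite /= aC aD.
pose P C := [&& C \in W, C != A & a \in C].
case: (pickP P) => [B0 PB0|no]; last first.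
  have /card_gt1P[x [y [xA yA xy]]] := cW A AW.
  exists (if a == x then y else x); split=> [||C CW nC aC].
  - by case: ifP.
  - by have [->|] := eqVneq a x.
  by have := no C; rewrite /P CW nC aC.
have [B /and3P[BW nBA aB] maxB] := arg_maxnP (fun A : {set 'I_n} => #|A|) PB0.
have BA : B \proper A.
  rewrite properEneq nBA; have [//|AB] := meet _ _ BW AW nBA aB aA.
  have e : A == B by rewrite eqEcard AB; exact: maxA.
  by rewrite eq_sym e in nBA.
have /properP[_ [b bA nbB]] := BA.
exists b; split=> //; first by apply: contraNneq nbB => <-.
move=> C CW nCA aC; apply/negP => bC.
have nCB : C != B by apply: contraNneq nbB => <-.
have [/subsetP/(_ b bC)|BC] := meet _ _ CW BW nCB aC aB; first by rewrite (negPf nbB).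
have : C \in P by rewrite unfold_in /P CW nCA.
move=> /maxB cC; case/negP: nCB.
by rewrite eq_sym eqEcard BC; exact: cC.
Qed.

(** For a pure involution h, reversing a word of h gives a word of h whose list of walls is
    reversed without renaming strands.  Hence the first letter of a geodesic is also, up to
    commutations, a last letter. *)
Lemma no_pure_involution g : g * g = 1 -> cactus_perm g = 1 -> g = 1.
Proof.
move=> gg pg; have [//|g1] := eqVneq g 1.
have [h [h1 hh ph hmin]] : exists h, [/\ h != 1, h * h = 1, cactus_perm h = 1 &
    forall s, len h <= len (sgen s * h * sgen s)].
  have [k] := ubnP (len g); elim: k g gg pg g1 => // k IH g gg pg g1 ltk.
  have [[s sg]|no] := pselect (exists s, len (sgen s * g * sgen s) < len g); last first.
    by exists g; split=> // s; rewrite leqNgt; apply/negP => lt; apply: no; exists s.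
  apply: (IH (sgen s * g * sgen s)); last by lia.
  - by rewrite !mulgA -[_ * sgen s * sgen s]mulgA sgenK mulg1 -[_ * g * g]mulgA gg mulg1 sgenK.
  - rewrite !cactus_permM pg mulg1 -cactus_permM sgenK; exact: cactus_perm1.
  apply: contra_neq g1 => e.
  have : sgen s * (sgen s * g * sgen s) * sgen s = 1 by rewrite e mulg1 sgenK.
  by rewrite !mulgA sgenK mul1g -mulgA sgenK mulg1.
(* If s still led the rest of the reversed word, s h s would be shorter than h. *)
have key w s : cactus_class (s :: w) = h -> size (s :: w) = len h ->
    all (laminar (supp s)) (behead (walls (s :: w))).
  move=> ew sw; set W1 := behead _.
  have hV : h^-1 = h by apply: (mulgI h); rewrite mulgV hh.
  have wp : word_perm (s :: w) = 1 by rewrite -cactus_permE ew.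
  have revw : walls (rev (s :: w)) = rcons (rev W1) (supp s).
    rewrite walls_rev wp invg1 /= rev_cons (eq_map (g := id)) ?map_id //.
    by move=> A; apply/setP => m; rewrite inE perm1.
  have erev : cactus_class (rev (s :: w)) = h by rewrite cactus_class_rev ew.
  have srev : size (rev (s :: w)) = len h by rewrite size_rev.
  have : lead (supp s) (walls (rev (s :: w))).
    rewrite -(lead_shuffle LI _ (trace_geodesic _)) ?erev // -ew.
    by rewrite (lead_shuffle LI _ (trace_geodesic _)) ?ew //= eqxx.
  rewrite revw => /lead_rcons[]; last by rewrite all_rev.
  have /rcons_inj[<- _] : rcons (walls (rev w)) (word_perm (rev w) @^-1: supp s) =
      rcons (rev W1) (supp s).
    by rewrite -revw rev_cons -[rcons (rev w) s]cats1 walls_cat cats1.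
  case/walls_lead => s' [v [/supp_inj <- ev sv]].
  have := hmin s; rewrite -{2}erev rev_cons -cats1 cactus_classM ev sgen_cons.
  rewrite -/(sgen s) !mulgA sgenK mul1g -mulgA sgenK mulg1.
  by have := len_class v; rewrite -sw /=; move: sv; rewrite size_rev; lia.
have [w ew sw] := geodesic_ex h; have sw' : size w = len (cactus_class w) by rewrite ew.
set W := walls w.
(* Any leading wall is the first wall of some geodesic. *)
have keyW A : lead A W -> all (laminar A) (rem A W).
  move=> lA; have [s [v [eA ev sv]]] := walls_lead lA.
  have szv : size (s :: v) = len h by rewrite -sw sv.
  have := key v s (etrans (esym ev) ew) szv.
  rewrite -eA; congr is_true; apply/perm_all.
  have : perm_eq (walls (s :: v)) W.
    apply: perm_trans (shuffle_perm LI (trace_geodesic sw')).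
    rewrite perm_sym ev; apply: (shuffle_perm LI); apply: trace_geodesic.
    by rewrite -ev ew.
  move=> /= pW; rewrite eA -(perm_cons (supp s)); apply: perm_trans pW _.
  by apply: perm_to_rem; rewrite -eA; exact: lead_mem lA.
(* Walls that commute with all the others can be jumped over: each wall in turn leads. *)
have allW (v u : seq {set 'I_n}) : W = v ++ u -> {in v, forall A, all (laminar A) (rem A W)}.
  elim/last_ind: v u => // v A IH u eW; have eW' : W = v ++ A :: u by rewrite eW cat_rcons.
  have {}IH := IH _ eW'; move=> B; rewrite mem_rcons inE => /orP[/eqP->|]; last exact: IH.
  apply: keyW; rewrite eW'; apply: lead_pairwise => // C Cv D Du.
  have /allP := IH C Cv; apply; rewrite eW'.
  have -> : rem C (v ++ A :: u) = rem C v ++ A :: u.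
    by elim: (v) Cv => //= x v' IHv; rewrite inE eq_sym; case: eqVneq => //= _ /IHv->.
  by rewrite mem_cat Du orbT.
have {}allW A : A \in W -> all (laminar A) (rem A W).
  by apply: (allW W [::]); rewrite cats0.
have WV : walls w != [::].
  by rewrite -size_eq0 size_walls; apply: contraNneq h1 => /size0nil e; rewrite -ew e.
have uW : uniq W.
  have H A : A \in W -> A \notin rem A W.
    by move=> /allW/allP H; apply/negP => /H; rewrite LI.
  elim: (W) H => //= A W' IH H; have := H A (mem_head _ _); rewrite /= eqxx => nA.
  rewrite nA IH // => B BW; have := H B; rewrite inE BW orbT => /(_ isT).
  by case: eqVneq BW => [<-|_ _]; [rewrite (negPf nA)|rewrite inE negb_or => /andP[]].
have [|A B AW BW nAB|a [b [nab e]]] := clique_odd_pair uW WV.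
- by move=> A; exact: walls_card.
- by have /allP := allW A AW; apply; rewrite (mem_rem_uniq _ uW) !inE eq_sym nAB.
have := parity_walls w nab; rewrite -cactus_permE ew ph !perm1 e addbT.
by case: (a < b).
Qed.

Lemma no_pure_torsion m g : 0 < m -> g ^+ m = 1 -> cactus_perm g = 1 -> g = 1.
Proof.
have [k] := ubnP m; elim: k m => // k IH m ltk m0 gm pg.
have [om|em] := boolP (odd m); first exact: no_odd_torsion gm.
have em' : m = (m./2 * 2)%N by rewrite muln2 even_halfK.
apply: (IH m./2) => //; [by lia|by lia|].
apply: no_pure_involution; last by rewrite cactus_permX pg expg1n.
by rewrite -expgnDr addnn -muln2 -em'.
Qed.

End Walls.

(** * Cloning strands is injective *)

Section Clone.
Variable n : nat.
Implicit Types (i : 'I_n) (s : gen n) (w : seq (gen n)).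

(** Sends the children of leaf i to i and every other leaf to its origin. *)
Definition collapse i (m : 'I_n.+1) : 'I_n := odflt i (unlift (rchild i) m).

Lemma collapse_lift i : cancel (lift (rchild i)) (collapse i).
Proof. by move=> k; rewrite /collapse liftK. Qed.

Lemma collapse_rchild i : collapse i (rchild i) = i.
Proof. by rewrite /collapse unlift_none. Qed.

Lemma collapseE i m : collapse i m = (if m <= i then m : nat else m.-1) :> nat.
Proof.
case: (unliftP (rchild i) m) => [k|] ->; last first.
  by rewrite collapse_rchild /= /bump /=; case: ifP; lia.
by rewrite collapse_lift /= /bump /=; case: ifP; lia.
Qed.

(** Effect of cloning the strand i on a set of strands. *)
Definition thicken i (A : {set 'I_n}) : {set 'I_n.+1} := collapse i @^-1: A.

Lemma thicken_inj i : injective (thicken i).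
Proof. exact: (preim_inj (@collapse_lift i)). Qed.

Lemma laminar_thicken i : {mono thicken i : A B / laminar A B >-> laminar A B}.
Proof. exact: (laminar_preim (@collapse_lift i)). Qed.

Lemma collapse_perm i s m :
  collapse (flip s i) (word_perm (clone_gen i s) m) = flip s (collapse i m).
Proof.
have -> : word_perm (clone_gen i s) = lift_perm (rchild i) (rchild (flip s i)) (flip s).
  have := cactus_perm_clone i (cactus_class [:: s]).
  by rewrite cactus_cloneE !cactus_permE /= cats0 mulg1.
case: (unliftP (rchild i) m) => [k|] ->; first by rewrite lift_perm_lift !collapse_lift.
by rewrite lift_perm_id !collapse_rchild.
Qed.

Lemma thicken_perm i s (A : {set 'I_n}) :
  word_perm (clone_gen i s) @^-1: thicken (flip s i) A = thicken i (flip s @^-1: A).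
Proof. by apply/setP => m; rewrite !inE collapse_perm. Qed.

Lemma walls_clone_gen i s :
  [seq A <- walls (clone_gen i s) | A != thicken i [set i]] = [:: thicken i (supp s)].
Proof.
have L := glo_lt_ghi s.
have ne : thicken i (supp s) != thicken i [set i].
  rewrite (inj_eq (@thicken_inj i)); apply/eqP => e.
  have := @walls_card n [:: s] (supp s) (mem_head _ _).
  by rewrite e cards1.
rewrite /clone_gen; case: ifP => [h|/negbT h]; last case: ifP => [h'|/negbT h'] /=.
- have e : supp (mkgen (lchild_lt_lchild s)) = thicken i (supp s).
    by apply/setP => m; rewrite !inE !collapseE /=; case: ifP; lia.
  by rewrite /= e ne.
- have e : supp (mkgen (rchild_lt_rchild s)) = thicken i (supp s).
    by apply/setP => m; rewrite !inE !collapseE /= /bump /=; case: ifP; lia.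
  by rewrite /= e ne.
have -> : supp (mkgen (caret_lt i)) = thicken i [set i].
  apply/setP => m; rewrite !inE -val_eqE /= !collapseE /bump /=; case: ifP; lia.
have e : supp (mkgen (lchild_lt_rchild s)) = thicken i (supp s).
  by apply/setP => m; rewrite !inE !collapseE /= /bump /=; case: ifP; lia.
rewrite eqxx /= e flip_preim_sub ?ne //.
by apply/subsetP => m; rewrite !inE /= !collapseE /bump /=; case: ifP; lia.
Qed.

(** Cloning strand i thickens all the sets and inserts copies of the pair of children of i,
    which is the thickening of {i}. *)
Lemma walls_clone i w :
  [seq A <- walls (clone_word i w) | A != thicken i [set i]] =
  [seq thicken i A | A : {set 'I_n} <- walls w].
Proof.
elim: w i => //= s w IH i; rewrite walls_cat filter_cat walls_clone_gen /=; congr cons.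
rewrite filter_map -map_comp.
rewrite (eq_filter (a2 := fun A => A != thicken (flip s i) [set flip s i])); last first.
  move=> A /=; have -> : thicken i [set i] = word_perm (clone_gen i s) @^-1:
      thicken (flip s i) [set flip s i].
    rewrite thicken_perm; congr thicken; apply/setP => m.
    by rewrite !inE (inj_eq perm_inj).
  by rewrite (inj_eq (@preim_perm_inj _ _)).
by rewrite IH -map_comp; apply: eq_map => A /=; rewrite thicken_perm.
Qed.

(** The pair of children of i is disjoint from, or contained in, every thickened set, so that
    it commutes with all of them; discarding it from the reduced form of a clone leaves the
    thickened reduced form of the original. *)
Lemma cactus_clone_inj i (g : cactus n) : cactus_clone i g = 1 -> g = 1.
Proof.
have [w <- sw] := geodesic_ex g.
rewrite cactus_cloneE => /(@cactus_classP _ _ [::]) /walls_equiv.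
move=> /(shuffle_perm (@laminar_irr _)) /perm_nilP => e0.
have := @filter_reduce_central _ _ (@laminar_irr n.+1) (thicken i [set i])
  (walls (clone_word i w)).
rewrite e0 walls_clone -(map_reduce (@thicken_inj i) (@laminar_thicken i)) reduce_id;
  last exact: geodesic_reduced.
move=> H; have {H} : [::] = [seq thicken i A | A : {set 'I_n} <- walls w].
  apply: H; apply/allP => A Aw; have [->|nA] := eqVneq A; first by [].
  have : A \in [seq A <- walls (clone_word i w) | A != thicken i [set i]].
    by rewrite mem_filter nA.
  rewrite walls_clone => /mapP[B _ eA]; move: nA; rewrite eA (inj_eq (@thicken_inj i)) => nB.
  rewrite laminar_thicken /laminar nB sub1set disjoint_sym disjoints_subset sub1set inE.
  by rewrite orbCA orNb orbT.
by case: (w).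
Qed.

End Clone.

(** * Torsion elements of tree pair groups *)

Fixpoint join (A B : bintree) : bintree :=
  match A, B with
  | Leaf, _ => B
  | _, Leaf => A
  | Node l r, Node l' r' => Node (join l l') (join r r')
  end.

Lemma subtree_joinl A B : subtree A (join A B).
Proof.
by elim: A B => // l IHl r IHr [|l' r'] /=; rewrite ?IHl ?IHr // !subtree_refl.
Qed.

Lemma subtree_joinr A B : subtree B (join A B).
Proof.
by elim: A B => [|l IHl r IHr] [|l' r'] //=; rewrite ?IHl ?IHr // !subtree_refl.
Qed.

Lemma join_subtree A B D : subtree A D -> subtree B D -> subtree (join A B) D.
Proof.
elim: A B D => [|l IHl r IHr] [|l' r'] [|l'' r''] //= /andP[a b] /andP[c d].
by rewrite IHl ?IHr.
Qed.

Lemma subtree_trans A B D : subtree A B -> subtree B D -> subtree A D.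
Proof.
elim: A B D => [|l IHl r IHr] [|l' r'] [|l'' r''] //= /andP[a b] /andP[d e].
by rewrite (IHl _ _ a d) (IHr _ _ b e).
Qed.

Lemma subtree_attach A i : subtree A (attach_caret A i).
Proof.
elim: A i => //= l IHl r IHr i.
by case: ifP => _ /=; rewrite ?IHl ?IHr ?subtree_refl.
Qed.

Lemma attach_caret_inj A B i : attach_caret A i = attach_caret B i -> A = B.
Proof.
have nL D j : attach_caret D j <> Leaf by case: D => //= l r; case: ifP.
elim: A B i => [|l IHl r IHr] [|l' r'] i //=.
- by case: ifP => _ [] => [/esym/nL|_ /esym/nL].
- by case: ifP => _ [] => [/nL|_ /nL].
case: ifP => [li|li]; case: ifP => [li'|li'] [].
- by move=> /IHl-> ->.
- by move=> e; move: li li'; rewrite -e leaves_attach_caret; lia.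
- by move=> e; move: li li'; rewrite e leaves_attach_caret; lia.
by move=> -> /IHr->.
Qed.

Section TreePairs.

Variable c : cloning_system.
Hypothesis clone_inj : forall n (i : 'I_n) (g : grp c n), clone i g = 1 -> g = 1.
Notation perm_of := Defs.perm_of.

Lemma perm_of_one n : perm_of (1 : grp c n) = 1.
Proof. by apply: (mulgI (perm_of (1 : grp c n))); rewrite -perm_ofM !mulg1. Qed.

Lemma clone_one n (i : 'I_n) : clone i (1 : grp c n) = 1.
Proof.
apply: (mulgI (clone i (1 : grp c n))).
by rewrite -{2}[i]perm1 -perm_of_one -cloneM !mulg1.
Qed.

Definition trivial_pair (x : tree_pair c) : Prop := upper x = lower x /\ middle x = 1.

Lemma trivial_expand x (i : 'I_(psize x)) : trivial_pair (expand i) <-> trivial_pair x.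
Proof.
case: x i => n A g B /= i; rewrite /trivial_pair /=; split=> [[e /clone_inj g1]|[-> ->]].
  rewrite g1 perm_of_one perm1 in e *; split=> //; apply: val_inj.
  by have /= := congr1 val e; exact: attach_caret_inj.
by rewrite perm_of_one perm1 clone_one.
Qed.

(** Triviality of a pair is preserved by expansions, and also by their inverses because
    cloning is injective. *)
Lemma trivial_class x : pair_class x = 1 -> trivial_pair x.
Proof.
have H y z : pair_equiv y z -> trivial_pair y <-> trivial_pair z.
  elim=> {y z} [y z [i ->]|y|y z _ [yz zy]|y z t _ [yz zy] _ [zt tz]]; split=> //; auto.
  - by move/trivial_expand.
  - by move/trivial_expand.
by rewrite -[1]/(class_one c) => /pair_classP/H[_]; apply.
Qed.

(** The element u maps the tree A to the tree B: it is represented by a pair (A, g, B). *)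
Definition carries (u : tree_pair_group c) (A B : bintree) : Prop :=
  exists n (TA TB : tree n) (g : grp c n),
    [/\ u = pair_class (TreePair TA g TB), val TA = A & val TB = B].

Lemma carries_ex u : exists A B, carries u A B.
Proof.
have [[n A g B] <-] := pair_class_surj u.
by exists (val A), (val B), n, A, B, g.
Qed.

Lemma carries_leaves u A B : carries u A B -> leaves A = leaves B.
Proof. by case=> n [TA [TB [g [_ <- <-]]]]; rewrite (eqP (valP TA)) (eqP (valP TB)). Qed.

Lemma carries1 A : carries 1 A A.
Proof.
have sA : leaves A == leaves A by [].
exists (leaves A), (exist _ A sA), (exist _ A sA), 1; split=> //.
by rewrite -[LHS]/(class_one c) (class_oneE c (exist _ A sA)).
Qed.

Lemma carriesV u A B : carries u A B -> carries u^-1 B A.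
Proof.
case=> n [TA [TB [g [-> <- <-]]]]; exists n, TB, TA, g^-1; split=> //.
by rewrite -[LHS]/(class_inv _) class_invE.
Qed.

Lemma carriesM u v A B D : carries u A B -> carries v B D -> carries (u * v) A D.
Proof.
case=> n [TA [TB [g [-> <- <-]]]] [n' [TB' [TD [h [-> eB <-]]]]].
have en : n' = n by rewrite -(eqP (valP TB)) -(eqP (valP TB')) /= eB.
subst n'; rewrite (val_inj eB); exists n, TA, TD, (g * h); split=> //.
by apply: class_mulE; constructor.
Qed.

Lemma carries_fun u A B B' : carries u A B -> carries u A B' -> B = B'.
Proof.
move=> /carriesV uBA /(carriesM uBA); rewrite mulVg.
by case=> n [TB [TB' [g [/esym/trivial_class[/= -> _] <- <-]]]].
Qed.

Lemma carries_subtree u A B A' : carries u A B -> subtree A A' ->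
  exists2 B', subtree B B' & carries u A' B'.
Proof.
have [k] := ubnP (leaves A' - leaves A); elim: k A B => // k IH A B ltk uAB AA'.
have [eq|ne] := eqVneq (leaves A) (leaves A').
  by exists B; [exact: subtree_refl|rewrite -(subtree_eq AA' eq)].
have lt : leaves A < leaves A' by rewrite ltn_neqAle ne subtree_leaves.
have [i ltiA si] := subtree_step AA' lt.
case: uAB => n [TA [TB [g [eu eA eB]]]].
have lti : i < n by rewrite -(eqP (valP TA)) /= eA.
have [||B' BB' uB'] := IH (attach_caret A i) (attach_caret B (perm_of g (Ordinal lti))) _ _ si.
- by rewrite leaves_attach_caret; lia.
- exists n.+1, (attach TA (Ordinal lti)), (attach TB (perm_of g (Ordinal lti))),
    (clone (Ordinal lti) g); split; rewrite /= ?eA ?eB //.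
  rewrite eu; apply/pair_classP/rst_step.
  by exists (Ordinal lti : 'I_(psize (TreePair TA g TB))).
by exists B' => //; apply: subtree_trans BB'; exact: subtree_attach.
Qed.

Definition join_all (S : nat -> bintree) m := foldr join Leaf [seq S k | k <- iota 0 m].

Lemma join_all_sub S m k : k < m -> subtree (S k) (join_all S m).
Proof.
move=> km; have : k \in iota 0 m by rewrite mem_iota.
rewrite /join_all; elim: (iota 0 m) => //= j r IH; rewrite inE => /orP[/eqP->|/IH kr].
  exact: subtree_joinl.
exact: subtree_trans kr (subtree_joinr _ _).
Qed.

Lemma join_all_lub S m D : (forall k, k < m -> subtree (S k) D) -> subtree (join_all S m) D.
Proof.
move=> H; have {}H : {in iota 0 m, forall k, subtree (S k) D}.
  by move=> k; rewrite mem_iota; exact: H.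
rewrite /join_all; elim: (iota 0 m) H => //= j r IH H; apply: join_subtree.
  by apply: H; rewrite mem_head.
by apply: IH => k kr; apply: H; rewrite inE kr orbT.
Qed.

(** The tree T is the join of the images f k of S under the powers u^k.  Its image U under u
    contains all the f k.+1, that is, all these images again; so U contains T. *)
Lemma torsion_carries u m : 0 < m -> u ^+ m = 1 -> exists T, carries u T T.
Proof.
move=> m0 um; have umod k : u ^+ k = u ^+ (k %% m).
  by rewrite {1}(divn_eq k m) expgnDr mulnC expgM um expg1n mul1g.
have [D HD] := choice (fun k => carries_ex (u ^+ k)).
pose S := join_all D m.
have /choice[f Hf] k : exists B, carries (u ^+ k) S B.
  rewrite umod.
  have [B uB] := HD (k %% m).
  have [|B' _ uB'] := carries_subtree uB (A' := S); last by exists B'.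
  by apply: join_all_sub; rewrite ltn_mod.
have f0 : f 0 = S by apply: (carries_fun (Hf 0)); rewrite expg0; exact: carries1.
have fmod k : f k = f (k %% m).
  by apply: (carries_fun (Hf k)); rewrite umod; exact: Hf.
pose T := join_all f m.
have fT k : subtree (f k) T by rewrite fmod; apply: join_all_sub; rewrite ltn_mod.
have ST : subtree S T by rewrite -f0.
have [U _ uTU] : exists2 U, subtree (f 1%N) U & carries u T U.
  by apply: carries_subtree ST; rewrite -{1}[u]expg1; exact: Hf.
(* Extend S to the tree P that u^k maps to T; then u^(k+1) maps P to U and S to f k.+1. *)
have fU k : subtree (f k.+1) U.
  have [P SP /carriesV] := carries_subtree (carriesV (Hf k)) (fT k).
  rewrite invgK => /carriesM/(_ uTU); rewrite -expgSr => uPU.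
  have [U' fU' uPU'] := carries_subtree (Hf k.+1) SP.
  by rewrite (carries_fun uPU uPU').
have TU : subtree T U.
  apply: join_all_lub => k _; have := fU (k + m.-1)%N.
  by rewrite -addnS prednK // fmod modnDr -fmod.
by exists T; rewrite {2}(subtree_eq TU (carries_leaves uTU)).
Qed.

Lemma pair_classX n (T : tree n) (g : grp c n) k :
  pair_class (TreePair T g T) ^+ k = pair_class (TreePair T (g ^+ k) T).
Proof.
elim: k => [|k IH]; first by rewrite !expg0 -(class_oneE c T).
by rewrite !expgS IH; apply: class_mulE; constructor.
Qed.

Lemma torsion_pair u m : 0 < m -> u ^+ m = 1 ->
  exists n (T : tree n) (g : grp c n), u = pair_class (TreePair T g T) /\ g ^+ m = 1.
Proof.
move=> m0 um; have [_ [n [TA [TB [g [eu <- /val_inj eT]]]]]] := torsion_carries m0 um.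
rewrite eT in eu; exists n, TA, g; split=> //.
by move: um; rewrite eu pair_classX => /trivial_class[].
Qed.

End TreePairs.

(** * Cauchy's theorem for finite subgroups of arbitrary groups *)

Section FiniteSubgroup.

Variables (G : groupType) (s : seq G).

(** The type of the elements of s, which the closure proof turns into a finite group. *)
Definition finite_subgroup of group_closed (mem s) : predArgType := seq_sub s.

Hypothesis sG : group_closed (mem s).
Notation H := (finite_subgroup sG).

HB.instance Definition _ := Finite.on H.
HB.instance Definition _ := [isSub for (@ssval G s : H -> G)].
HB.instance Definition _ := SubChoice_isSubGroup.Build G (mem s) H sG.

Lemma finite_subgroup_Cauchy p : uniq s -> prime p -> p %| size s ->
  exists2 x : G, x != 1 & x ^+ p = 1.
Proof.
move=> us pr_p; rewrite -(card_seq_sub us) -[#|_|]/(#|H|) -cardsT => pH.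
have [x _ ox] := Cauchy pr_p pH; exists (val x).
  apply: contraTneq pr_p => x1; rewrite -ox.
  have -> : x = 1 by apply: val_inj; rewrite x1.
  by rewrite order1.
have : x ^+ p = 1 by rewrite -ox expg_order.
by move=> /(congr1 val); rewrite gmulf1 gmulfXn.
Qed.

End FiniteSubgroup.

Lemma expg_gcd (G : groupType) (x : G) a b : 0 < a ->
  x ^+ a = 1 -> x ^+ b = 1 -> x ^+ gcdn a b = 1.
Proof.
move=> a0 xa xb; case: (egcdnP b a0) => ka kb e _.
have := congr1 (fun k => x ^+ k) e.
by rewrite /= expgnDr [(ka * a)%N]mulnC [(kb * b)%N]mulnC !expgM xa xb !expg1n mul1g.
Qed.

(** * Cactus elements of order a power of two *)

Section RootsOfFlips.

Variable n : nat.
Implicit Types (s t : gen n) (v w : seq (gen n)).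

Lemma class_commute m v w : all (fun s => ghi s < m) v -> all (fun t => m <= glo t) w ->
  commute (cactus_class v) (cactus_class w).
Proof.
have H s u : all (fun t => ghi s < glo t) u -> commute (sgen s) (cactus_class u).
  elim: u => [|t u IH] /=; first by move=> _; exact: commute1.
  move=> /andP[st su]; rewrite sgen_cons; apply: commuteM; last exact: IH.
  by rewrite /commute -!cactus_classM; apply: cactus_class_rel; constructor.
elim: v => [|s v IH] /=; first by move=> _ _; exact/commute_sym/commute1.
move=> /andP[sm sv] wm; rewrite sgen_cons; apply/commute_sym/commuteM; apply/commute_sym.
  by apply: H; apply: sub_all wm => t /=; lia.
exact: IH.
Qed.

(** Conjugation by the flip s of an initial segment moves words on its first m strands to its
    last m strands. *)
Lemma class_reflect s m v :
  glo s = 0 :> nat -> all (fun t => ghi t < m) v -> m <= (ghi s).+1 ->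
  exists2 w, sgen s * cactus_class v * sgen s = cactus_class w &
    all (fun t => (ghi s).+1 - m <= glo t) w.
Proof.
move=> s0 + ms; elim: v => [|t v IH] /=; first by exists [::]; rewrite // mulg1 sgenK.
case/andP => tm /IH[w ew aw]; have Lt := glo_lt_ghi t.
have Ls := ltn_ord (ghi s).
have [||u [u1 u2]] := @gen_ex n (glo s + ghi s - ghi t) (glo s + ghi s - glo t); [lia|lia|].
exists (u :: w); last by rewrite /= aw u1; lia.
rewrite !sgen_cons -ew !mulgA; congr (_ * _ * _).
have -> : sgen u = sgen s * sgen t * sgen s; last first.
  by rewrite -[RHS]mulgA sgenK mulg1.
have -> : sgen s * sgen t = sgen u * sgen s.
  by rewrite -!cactus_classM; apply: cactus_class_rel; constructor; lia.
by rewrite -mulgA sgenK mulg1.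
Qed.

Lemma word_perm_fix w (a : 'I_n) : all (fun s => a < glo s) w -> word_perm w a = a.
Proof.
elim: w => [|s w IH] /=; first by rewrite perm1.
move=> /andP[as_ aw]; have fa : flip s a = a.
  by apply: val_inj; rewrite /= flipE; case: ifP; lia.
by rewrite permM fa IH.
Qed.

(** If x is such an element for 2^k strands and r flips the first 2^(k+1) strands, then
    (x r)^2 = x (r x r), where r x r acts on the last 2^k of these strands and so commutes
    with x.  Hence x r has twice the order of x.  That (x r)^(2^k) sends strand 0 to strand 1
    keeps this order from dropping. *)
Lemma order_pow2_word k : 0 < k -> 2 ^ k <= n -> exists w (i j : 'I_n),
  [/\ all (fun s => ghi s < 2 ^ k) w, cactus_class w ^+ (2 ^ k) = 1, i = 0 :> nat,
      j = 1%N :> nat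
    & (word_perm w ^+ (2 ^ k.-1)) i = j].
Proof.
case: k => // k _; elim: k => [|k IH] kn.
  have n0 : 0 < n by lia.
  have n1 : 1 < n by lia.
  exists [:: @mkgen n (Ordinal n0) (Ordinal n1) isT], (Ordinal n0), (Ordinal n1).
  split=> //=; first by rewrite expn1 expgS expg1 sgenK.
  by rewrite expn0 expg1 mulg1; apply: val_inj; rewrite /= flipE.
have kn' : 2 ^ k.+1 <= n by rewrite (leq_trans _ kn) // leq_exp2l.
have [v [i [j [av ov i0 j1 pv]]]] := IH kn'.
have e2 : (2 ^ k.+2 = 2 ^ k.+1 + 2 ^ k.+1)%N by rewrite expnS mul2n addnn.
have k0 : 1 < 2 ^ k.+1 by rewrite -{1}(expn0 2) ltn_exp2l.
have [||s [s0 s1]] := @gen_ex n 0 (2 ^ k.+2).-1; [lia|lia|].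
have [|w ew aw] := class_reflect s0 av; first by lia.
have aw' : all (fun t => 2 ^ k.+1 <= glo t) w by apply: sub_all aw => t /=; lia.
have cvw := class_commute av aw'.
have sq : cactus_class (rcons v s) ^+ 2 = cactus_class v * cactus_class w.
  by rewrite -cats1 cactus_classM -ew expgS expg1 !mulgA.
have pw : word_perm w j = j by apply: word_perm_fix; apply: sub_all aw' => t /=; lia.
exists (rcons v s), i, j; split=> //.
- rewrite all_rcons s1; apply/andP; split; first by lia.
  by apply: sub_all av => t /=; lia.
- rewrite expnS expgM sq expgMn // ov mul1g -ew.
  have -> : sgen s * cactus_class v * sgen s = cactus_class v ^ sgen s.
    by rewrite /conjg sgenV mulgA.
  by rewrite -conjXg ov conj1g.
rewrite /= expnS expgM -!cactus_permE -!cactus_permX sq expgMn // cactus_permM.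
rewrite !cactus_permX !cactus_permE permM pv.
by elim: (2 ^ k)%N => [|m IHm]; rewrite ?expg0 ?perm1 // expgS permM pw.
Qed.

End RootsOfFlips.

(** * Torsion of the cactus Thompson group *)

Lemma bintree_ex n : 0 < n -> exists t, leaves t = n.
Proof.
case: n => // n _; elim: n => [|n [t et]]; first by exists Leaf.
by exists (Node Leaf t); rewrite /= et.
Qed.

Lemma perm_clone_inj n (i : 'I_n) (g : 'S_n) : perm_clone i g = 1 -> g = 1.
Proof.
move=> /permP H; apply/permP => k; have := H (lift (rchild i) k).
have := H (rchild i); rewrite /perm_clone lift_perm_id lift_perm_lift !perm1.
by move=> -> /lift_inj.
Qed.

Lemma CV_torsion (g : CV) m : 0 < m -> g ^+ m = 1 -> exists n (T : tree n) (s : cactus n),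
  g = pair_class (@TreePair cactus_cloning n T s T) /\ s ^+ m = 1.
Proof. exact: (torsion_pair (c := cactus_cloning) cactus_clone_inj). Qed.

Lemma CV_no_odd_torsion (g : CV) m : odd m -> g ^+ m = 1 -> g = 1.
Proof.
move=> om gm; have m0 : 0 < m by case: m om {gm}.
have [n [T [s [-> sm]]]] := CV_torsion m0 gm.
by rewrite (no_odd_torsion om sm) -(class_oneE cactus_cloning T).
Qed.

Lemma PCV_torsion_free (g : CV) m : pi_bar g = 1 -> 0 < m -> g ^+ m = 1 -> g = 1.
Proof.
move=> pg m0 gm; have [n [T [s [eg sm]]]] := CV_torsion m0 gm.
move: pg; rewrite eg pi_barE => /(trivial_class (c := perm_cloning) perm_clone_inj) [_ /= ps].
by rewrite (no_pure_torsion m0 sm ps) -(class_oneE cactus_cloning T).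
Qed.

Lemma CV_order_pow2 k : 0 < k -> exists g : CV, has_order g (2 ^ k).
Proof.
move=> k0; have n0 : 0 < 2 ^ k by rewrite expn_gt0.
have [w [i [j [_ ox i0 j1 pw]]]] := order_pow2_word k0 (leqnn (2 ^ k)%N).
have [t /eqP et] := bintree_ex n0; pose T : tree (2 ^ k)%N := exist _ t et.
exists (pair_class (@TreePair cactus_cloning _ T (cactus_class w) T)); split=> //.
  by rewrite pair_classX ox -(class_oneE cactus_cloning T).
move=> m /andP[m0 mk]; rewrite pair_classX.
move=> /(trivial_class (c := cactus_cloning) cactus_clone_inj) [_ /= xm].
have := expg_gcd m0 xm ox; have /dvdn_pfactor := dvdn_gcdr m (2 ^ k)%N.
move=> /(_ isT)[l lk el]; have lk' : l <= k.-1.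
  have : 2 ^ l < 2 ^ k by rewrite -el (leq_ltn_trans _ mk) // dvdn_leq // dvdn_gcdl.
  by rewrite ltn_exp2l //; lia.
rewrite el => xl; have : cactus_class w ^+ (2 ^ k.-1) = 1.
  by rewrite -(subnKC lk') expnD expgM xl expg1n.
move/(congr1 (fun x => cactus_perm x i)).
rewrite cactus_permX cactus_permE pw cactus_perm1 perm1.
by move/(congr1 val) => /=; rewrite i0 j1.
Qed.

From mathcomp Require Import classical_sets cardinality finmap.

Local Open Scope classical_set_scope.
Local Open Scope card_scope.

Theorem corollary3p6 :
  (forall (m : nat) (g : CV), odd m -> has_order g m -> g = 1) /\
  (forall k : nat, (1 <= k)%N -> exists g : CV, has_order g (2 ^ k)%N) /\
  (forall H : {pred CV}, group_closed H -> finite_set [set` H] ->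
     exists k : nat, [set` H] #= `I_(2 ^ k)%N) /\
  (forall (m : nat) (g : CV), g \in PCV -> has_order g m -> g = 1).
Proof.
split; [|split; [exact: CV_order_pow2|split]].
- by move=> m g om [_ gm _]; exact: CV_no_odd_torsion gm.
- move=> H gH /finite_fsetP[X eHX].
  have HX x : (x \in H) = (x \in X).
    have e : [set` H] x <-> [set` X] x by rewrite eHX.
    by apply/idP/idP => /e.
  have gX : group_closed (mem (enum_fset X)).
    by case: gH => H1 HD; split=> [|x y]; rewrite -!HX //; exact: HD.
  have N0 : (0 < size (enum_fset X))%N.
    by have : 1 \in enum_fset X := gX.1; case: (enum_fset X).
  have /p_natP[k eN] : 2.-nat (size (enum_fset X)).
    apply/(pnatP _ N0) => p pr_p pN.
    have [x x1 xp] := finite_subgroup_Cauchy gX (fset_uniq X) pr_p pN.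
    case: (even_prime pr_p) => [->//|op].
    by rewrite (CV_no_odd_torsion op xp) eqxx in x1.
  by exists k; rewrite eHX; apply/card_eq_fsetP.
move=> m g /eqP pg [m0 gm _]; exact: PCV_torsion_free pg m0 gm.
Qed.
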